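(* Assume that the Markov renewal kernel $q$ is strict. Let $\rho:\mathcal E\to\mathsf X$, $\rho(x,u)=x$, and for $h\in\mathbb N^d$, $A\in\mathcal X$, $(x,u)\in\mathcal E$ let $\Lambda_h((x,u),A)=R_h((x,u),A\times\mathbb N^d)$. The following assertions are equivalent. (L1) For every initial law concentrated on $\mathcal E$, the projected field $Z=\rho(Y)$ is a homogeneous $\mathbb N^d$-indexed Markov chain with respect to its lower-rectangle filtration $\mathcal G_k^Z=\sigma\{Z_m:m\leq_dk\}$. (L2) For every $h\in\mathbb N^d$ there exists a Markov kernel $P_h^Z$ on $\mathsf X$ such that $$\Lambda_h((x,u),A)=P_h^Z(x,A)$$ for every $A\in\mathcal X$ and every $(x,u)\in\mathcal E$. When these equivalent conditions hold, $(P_h^Z)_{h\in\mathbb N^d}$ is a Markov semigroup on $\mathsf X$: $$P^Z_{0_d}=I,\qquad P^Z_{h+r}=P^Z_hP^Z_r,\qquad h,r\in\mathbb N^d,$$ and the coordinate kernels $P^Z_{e_1},\dots,P^Z_{e_d}$ commute ($e_i$ being the $i$-th coordinate vector).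
   Context: Notation: $\mathbb N=\{0,1,2,\dots\}$, $d\ge1$; $r\leq_dk$ means $r_j\le k_j$ for all $j$, and $r\not\leq_dk$ its negation; $0_d$ is the zero vector. $(\mathsf X,\mathcal X)$ is a standard Borel space and $q=(q_k)_{k\in\mathbb N^d}$ is a family of non-negative kernels on $\mathsf X$ with $\sum_kq_k(x,\mathsf X)=1$ for all $x$; it is strict if $q_{0_d}=0$. The Markov renewal chain $(J_n,S_n)$ with kernel $q$ satisfies $\mathbb P(J_{n+1}\in A,S_{n+1}-S_n=k\mid J_0,S_0,\dots,J_n,S_n)=q_k(J_n,A)$; under $\mathbb P_y$ it starts from $J_0=y$, $S_0=0_d$. For $k\in\mathbb N^d$: $N(k)=\sup\{n\ge0:S_n\leq_dk\}$, $Z_k=J_{N(k)}$, $U_k=k-S_{N(k)}$, $Y_k=(Z_k,U_k)$. For $u\in\mathbb N^d$, $\overline H_u(x)=\sum_{v\not\leq_du}q_v(x,\mathsf X)$; $\mathcal E=\{(x,u)\in\mathsf X\times\mathbb N^d:\overline H_u(x)>0\}$; for $(x,u)\in\mathcal E$, $q^{\langle u\rangle}_v(x,A)=\mathbf 1_{\{v\not\leq_du\}}q_v(x,A)/\overline H_u(x)$. Field started from $(x,u)\in\mathcal E$: put $J_0=x$, $S_0=-u$, let $(J_1,S_1-S_0)$ have law $q^{\langle u\rangle}_v(x,dy)$ on pairs $(y,v)$, let all later transitions be governed by $q$, and define $N(k),Z_k,U_k$ by the same formulas (so $Y_{0_d}=(x,u)$). For a general initial law on $\mathcal E$, $Y_{0_d}$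 has that law. For $t\in\mathbb N^d$, $K_t((y,0_d),B)=\mathbb P_y((Z_t,U_t)\in B)$. For $(x,u)\in\mathcal E$, $h\in\mathbb N^d$, $$R_h((x,u),B)=\frac{\overline H_{u+h}(x)}{\overline H_u(x)}\mathbf 1_B(x,u+h)+\frac1{\overline H_u(x)}\sum_{v\leq_du+h,\; v\not\leq_du}\int_{\mathsf X}q_v(x,dy)K_{u+h-v}((y,0_d),B).$$ In (L1), being a homogeneous $\mathbb N^d$-indexed Markov chain with respect to $(\mathcal G^Z_k)$ means that there are Markov kernels $(P_h)_{h\in\mathbb N^d}$ on $\mathsf X$, not depending on the initial law, with $\mathbb E[f(Z_{k+h})\mid\mathcal G_k^Z]=P_hf(Z_k)$ for all $k,h\in\mathbb N^d$ and all bounded measurable $f$ on $\mathsf X$. *)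

(* Defs.v *)
From HB Require Import structures.
From mathcomp Require Import all_boot all_order all_algebra.
From mathcomp Require Import all_classical all_reals all_analysis.
From mathcomp Require Import measurable_realfun.

Set Implicit Arguments.
Unset Strict Implicit.
Unset Printing Implicit Defensive.
Import Order.TTheory GRing.Theory Num.Theory.
Import numFieldNormedType.Exports.
Local Open Scope classical_set_scope.
Local Open Scope ring_scope.
Local Open Scope ereal_scope.

(* N^d and Z^d, with their pointwise additive structure and the discrete
   sigma-algebra. *)
Definition Nvec (d : nat) : Type := {ffun 'I_d -> nat}.
HB.instance Definition _ (d : nat) := Countable.on (Nvec d).
HB.instance Definition _ (d : nat) := GRing.Nmodule.on (Nvec d).
HB.instance Definition _ (d : nat) := isPointed.Build (Nvec d) 0%R.
HB.instance Definition _ (d : nat) :=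
  @isMeasurable.Build default_measure_display (Nvec d) discrete_measurable
    discrete_measurable0 discrete_measurableC discrete_measurableU.

Definition Zvec (d : nat) : Type := {ffun 'I_d -> int}.
HB.instance Definition _ (d : nat) := Countable.on (Zvec d).
HB.instance Definition _ (d : nat) := GRing.Zmodule.on (Zvec d).
HB.instance Definition _ (d : nat) := isPointed.Build (Zvec d) 0%R.
HB.instance Definition _ (d : nat) :=
  @isMeasurable.Build default_measure_display (Zvec d) discrete_measurable
    discrete_measurable0 discrete_measurableC discrete_measurableU.

Section vectors.
Variable d : nat.

Definition lev (r k : Nvec d) : Prop := forall i, (r i <= k i)%N.

Definition subv (k v : Nvec d) : Nvec d := [ffun i => (k i - v i)%N].

Definition unitv (i : 'I_d) : Nvec d := [ffun j => (j == i) : nat].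

Definition toZ (k : Nvec d) : Zvec d := [ffun i => (k i)%:Z].

(* Left inverse of [toZ]; it is applied to -S_0 and k - S_{N(k)}, which are
   almost surely nonnegative. *)
Definition ofZ (s : Zvec d) : Nvec d := [ffun i => `|s i|%N].

Definition levZ (s : Zvec d) (k : Nvec d) : Prop :=
  forall i, (s i <= (k i)%:Z)%R.

End vectors.

(* Isomorphic to the Borel space of a separable complete metric space. *)
Definition standard_borel (R : realType) (dX : measure_display)
    (X : measurableType dX) : Prop :=
  exists (T : metricType R) (f : X -> T),
    [/\ forall F : set_system T, ProperFilter F -> cauchy F -> exists l : T, F --> l,
        exists2 D : set T, countable D & dense D,
        bijective f
      & forall A : set X,
          measurable A <-> <<s [set U : set T | open U] >> (f @` A)].

Section conditional_expectation.
Context (R : realType) (dO : measure_display) (Omega : measurableType dO).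

(* [eta] is a version of the conditional expectation of [xi] given the
   sub-sigma-algebra [G]. *)
Definition is_cond_exp (P : {measure set Omega -> \bar R}) (G : set (set Omega))
    (xi eta : Omega -> \bar R) : Prop :=
  [/\ P.-integrable setT xi,
      P.-integrable setT eta,
      forall B : set (\bar R), measurable B -> G (eta @^-1` B)
    & forall E, G E -> \int[P]_(w in E) eta w = \int[P]_(w in E) xi w].

End conditional_expectation.

Section renewal.
Context (R : realType) (d : nat) (dX : measure_display) (X : measurableType dX).
Variable q : Nvec d -> R.-ker X ~> X.

Definition renewal_kernel : Prop :=
  forall x, \esum_(k in [set: Nvec d]) q k x setT = 1.

Definition strict_kernel : Prop :=
  forall x A, measurable A -> q 0%R x A = 0.

Definition Hbar (u : Nvec d) (x : X) : \bar R :=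
  \esum_(v in [set v | ~ lev v u]) q v x setT.

Definition Espace : set (X * Nvec d) := [set z | 0 < Hbar z.2 z.1].

Definition qtrunc (u v : Nvec d) (x : X) (A : set X) : \bar R :=
  if `[< lev v u >] then 0 else q v x A / Hbar u x.

Section process.
Context (dO : measure_display) (Omega : measurableType dO).
Variables (J : nat -> {mfun Omega >-> X}) (S : nat -> {mfun Omega >-> Zvec d}).

Definition sigma_past (n : nat) : set (set Omega) :=
  <<s \bigcup_(m in [set m | (m <= n)%N])
        (preimage_set_system setT (J m) measurable `|`
         preimage_set_system setT (S m) measurable) >>.

(* P(J_{n+1} \in A, S_{n+1} - S_n = k | J_0, S_0, ..., J_n, S_n) is
   [kappa w k A]. *)
Definition transition (P : {measure set Omega -> \bar R}) (n : nat)
    (kappa : Omega -> Nvec d -> set X -> \bar R) : Prop :=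
  forall (k : Nvec d) (A : set X), measurable A ->
    is_cond_exp P (sigma_past n)
      (fun w => (\1_[set w | A (J n.+1 w) /\
                             (S n.+1 w - S n w)%R = toZ k] w)%:E)
      (fun w => kappa w k A).

Definition renewal_chain_from (P : {measure set Omega -> \bar R}) (y : X) :
    Prop :=
  {ae P, forall w, J 0 w = y /\ S 0 w = 0%R} /\
  forall n, transition P n (fun w k A => q k (J n w) A).

(* The initial position encodes (x, u) as J_0 = x, S_0 = -u, and the first
   step is conditioned to leave the rectangle below u. *)
Definition renewal_field_from (P : {measure set Omega -> \bar R})
    (mu : probability (X * Nvec d)%type R) : Prop :=
  [/\ forall (A : set X) (u : Nvec d), measurable A ->
        P [set w | A (J 0 w) /\ S 0 w = (- toZ u)%R] = mu (A `*` [set u]),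
      transition P 0
        (fun w k A => qtrunc (ofZ (- S 0%N w)%R) k (J 0 w) A)
    & forall n, (1 <= n)%N -> transition P n (fun w k A => q k (J n w) A)].

(* The supremum of [set n | S_n <= k], which is a maximum whenever the set is
   bounded (almost surely the case for a strict kernel); the default value 0
   is only used on the exceptional event. *)
Definition Ncount (k : Nvec d) (w : Omega) : nat :=
  xget 0%N [set n | levZ (S n w) k /\
                    forall m, levZ (S m w) k -> (m <= n)%N].

Definition Zfield (k : Nvec d) (w : Omega) : X := J (Ncount k w) w.

Definition Ufield (k : Nvec d) (w : Omega) : Nvec d :=
  ofZ (toZ k - S (Ncount k w) w)%R.

Definition Yfield (k : Nvec d) (w : Omega) : X * Nvec d :=
  (Zfield k w, Ufield k w).

Definition rhoY (k : Nvec d) (w : Omega) : X := (Yfield k w).1.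

Definition sigma_rect (k : Nvec d) : set (set Omega) :=
  <<s \bigcup_(m in [set m | lev m k])
        preimage_set_system setT (rhoY m) measurable >>.

Definition rect_markov (P : {measure set Omega -> \bar R})
    (Ph : Nvec d -> R.-pker X ~> X) : Prop :=
  forall (k h : Nvec d) (f : X -> R),
    measurable_fun setT f -> (exists M : R, forall x, (`|f x| <= M)%R) ->
    is_cond_exp P (sigma_rect k)
      (fun w => (f (rhoY (k + h)%R w))%:E)
      (fun w => \int[Ph h (rhoY k w)]_y (f y)%:E).

End process.

Definition L1 : Prop :=
  exists Ph : Nvec d -> R.-pker X ~> X,
  forall (mu : probability (X * Nvec d)%type R), mu Espace = 1 ->
  forall (dO : measure_display) (Omega : measurableType dO)
    (P : probability Omega R)
    (J : nat -> {mfun Omega >-> X}) (S : nat -> {mfun Omega >-> Zvec d}),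
    renewal_field_from J S P mu -> rect_markov J S P Ph.

Section kernels.
Context (dO : measure_display) (Omega : measurableType dO).
Variables (Py : R.-pker X ~> Omega) (J : nat -> {mfun Omega >-> X})
  (S : nat -> {mfun Omega >-> Zvec d}).

(* [Kker t y B] is K_t((y, 0), B). *)
Definition Kker (t : Nvec d) (y : X) (B : set (X * Nvec d)) : \bar R :=
  Py y [set w | B (Yfield J S t w)].

Definition Rker (h : Nvec d) (z : X * Nvec d) (B : set (X * Nvec d)) :
    \bar R :=
  let x := z.1 in let u := z.2 in
  Hbar (u + h)%R x / Hbar u x * (\1_B (x, (u + h)%R))%:E +
  (Hbar u x)^-1 *
    \esum_(v in [set v | lev v (u + h)%R /\ ~ lev v u])
      \int[q v x]_y Kker (subv (u + h)%R v) y B.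

Definition Lambda (h : Nvec d) (z : X * Nvec d) (A : set X) : \bar R :=
  Rker h z (A `*` [set: Nvec d]).

Definition lumps (h : Nvec d) (P : R.-pker X ~> X) : Prop :=
  forall (A : set X) (x : X) (u : Nvec d), measurable A ->
    Espace (x, u) -> Lambda h (x, u) A = P x A.

Definition L2 : Prop := forall h, exists P : R.-pker X ~> X, lumps h P.

End kernels.

End renewal.

Definition markov_semigroup (R : realType) (d : nat) (dX : measure_display)
    (X : measurableType dX) (P : Nvec d -> R.-pker X ~> X) : Prop :=
  (forall x A, measurable A -> P 0%R x A = \d_x A) /\
  (forall h r x A, measurable A ->
     P (h + r)%R x A = kcomp_noparam (P h) (P r) x A).

Definition coordinates_commute (R : realType) (d : nat) (dX : measure_display)
    (X : measurableType dX) (P : Nvec d -> R.-pker X ~> X) : Prop :=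
  forall (i j : 'I_d) x A, measurable A ->
    kcomp_noparam (P (unitv i)) (P (unitv j)) x A =
    kcomp_noparam (P (unitv j)) (P (unitv i)) x A.

(* Main.v *)
(* The field at [k + h] depends on the history inside the rectangle below [k]
   only through the last renewal before leaving it.  On the event that exactly
   [n] steps stay below [k] and [S_n = s], a set generated by [Z_m], [m <= k],
   agrees with one generated by the first [n] transitions, and the next step is
   known to leave the rectangle below [u = k - s].  Hence the conditional law of
   [Z_(k+h)] is [Lambda_h (J_n, u)]; if [Lambda_h] does not depend on [u], this
   is [P_h (Z_k, .)].  Conversely, evaluating the Markov property at [k = 0] for
   the field started from [(x, u)], realized by conditioning the chain from [x]
   on leaving the rectangle below [u] at its first step, gives
   [Lambda_h ((x, u), .) = P_h (x, .)].  The semigroup law is the Markov property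
   of the chain itself. *)

(* The field and the chain behind [Kker] live on unrelated probability spaces, and no uniqueness
   theorem for path laws is invoked to compare them. Both are reduced to the set identities of
   [renewal_flow], and the law of [Z] after a renewal is determined by induction on the [weight] of
   what is left of the rectangle: strictness makes every step nonzero, so a step that stays inside
   lowers the weight, and a first-step formula with the same right-hand side holds on either space.
   Events are cut into the countably many slices [S_n = s], on which the normalisation of the first
   step is a function of [J_n] alone. The lumping identity is used multiplied by the tail [Hbar],
   because [lumps] says nothing where the tail vanishes. The maximum in [Ncount] exists only almost
   surely, so path statements are made under [strict_path] and transferred by removing a null
   set. *)
Require Import Defs.
From HB Require Import structures.
From mathcomp Require Import all_boot all_order all_algebra.
From mathcomp Require Import all_classical all_reals all_analysis.
From mathcomp Require Import measurable_realfun.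
From mathcomp Require Import zify.

Set Implicit Arguments.
Unset Strict Implicit.
Unset Printing Implicit Defensive.
Local Open Scope classical_set_scope.
Local Open Scope ring_scope.

Import Order.TTheory GRing.Theory Num.Theory.

(** * Countable sums *)

Section countable_sums.
Local Open Scope ereal_scope.
Context (R : realType) (I : countType).

Lemma esum_series (D : set I) (a : I -> \bar R) :
  (forall i, D i -> 0 <= a i) ->
  \esum_(i in D) a i =
  \sum_(n <oo) oapp (fun i => if i \in D then a i else 0) 0 (pickle_inv n).
Proof.
move=> a0; have a'0 i : 0 <= if i \in D then a i else 0.
  by case: ifPn => // /set_mem /a0.
rewrite nneseries_esumT; last by move=> n; case: (@pickle_inv I n) => /=.
rewrite esum_mkcond; set b := RHS.
have -> : b = \esum_(n in range (@pickle I))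
    oapp (fun i => if i \in D then a i else 0) 0 (pickle_inv n).
  rewrite /b [RHS]esum_mkcond; apply: eq_esum => n _ /=.
  case: ifPn => // /negP nr; case E : (pickle_inv n) => [i|//]; exfalso; apply: nr.
  by apply/mem_set; exists i => //; have := @pickle_invK I n; rewrite E.
rewrite (@esum_image _ _ _ [set: I] (@pickle I)).
  by apply: eq_esum => i _; rewrite pickleK_inv.
by apply: in2W; apply: (pcan_inj (@pickleK_inv I)).
Qed.

Lemma esumZl (D : set I) (r : R) (a : I -> \bar R) :
  (0 <= r)%R -> (forall i, D i -> 0 <= a i) ->
  \esum_(i in D) (r%:E * a i) = r%:E * \esum_(i in D) a i.
Proof.
move=> r0 a0; rewrite !esum_series//; last first.
  by move=> i Di; rewrite mule_ge0 ?lee_fin// a0.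
rewrite -nneseriesZl; last first.
  by move=> n _; case: (@pickle_inv I n) => //= i; case: ifPn => // /set_mem/a0.
apply: eq_eseriesr => n _; case: (@pickle_inv I n) => [i|] /=; last by rewrite mule0.
by case: ifPn => // _; rewrite mule0.
Qed.

Context (dT : measure_display) (T : measurableType dT).

Lemma measurable_bigcup_countType (D : set I) (F : I -> set T) :
  (forall i, D i -> measurable (F i)) -> measurable (\bigcup_(i in D) F i).
Proof.
move=> mF; have -> : \bigcup_(i in D) F i =
    \bigcup_(i in setT) (if i \in D then F i else set0).
  apply/seteqP; split => [x [i Di Fx]|x [i _]].
    by exists i => //; rewrite mem_set.
  by case: ifPn => // /set_mem Di Fx; exists i.
apply: countable_bigcupT_measurable => // i.
by case: ifPn => // /set_mem/mF.
Qed.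

(** Measurability is assumed through preimages so that the lemma also applies to the
    sub-sigma-algebras generated by the past. *)
Lemma measurable_discrete_rel (f g : T -> I) (Q : I -> I -> Prop) :
  (forall B, measurable (f @^-1` B)) -> (forall B, measurable (g @^-1` B)) ->
  measurable [set w | Q (f w) (g w)].
Proof.
move=> mf mg; rewrite (_ : [set w | _] =
    \bigcup_(i in setT) (f @^-1` [set i] `&` g @^-1` (Q i))).
  by apply: measurable_bigcup_countType => i _; apply: measurableI.
by apply/seteqP; split => [w Qw|w [i _ [/= -> //]]]; exists (f w).
Qed.

Lemma measurable_esum (E : set T) (D : set I) (f : I -> T -> \bar R) :
  (forall i, D i -> measurable_fun E (f i)) ->
  (forall i x, D i -> 0 <= f i x) ->
  measurable_fun E (fun x => \esum_(i in D) f i x).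
Proof.
move=> mf f0.
have -> : (fun x => \esum_(i in D) f i x) = (fun x => \sum_(n <oo)
    oapp (fun i => if i \in D then f i x else 0) 0 (pickle_inv n)).
  by apply/funext => x; apply: esum_series => i Di; apply: f0.
apply: (@ge0_emeasurable_sum _ _ _ _ (fun n x =>
   oapp (fun i => if i \in D then f i x else 0) 0 (pickle_inv n)) xpredT).
  by move=> n x _ _; case: (@pickle_inv I n) => //= i; case: ifPn => // /set_mem /f0.
move=> n _; case: (@pickle_inv I n) => [i|] /=; last exact: measurable_cst.
by have [/set_mem/mf//|_] := boolP (i \in D); exact: measurable_cst.
Qed.

Context (mu : {measure set T -> \bar R}).

Lemma integral_esum (E : set T) (D : set I) (f : I -> T -> \bar R) :
  measurable E -> (forall i, D i -> measurable_fun E (f i)) ->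
  (forall i x, D i -> 0 <= f i x) ->
  \int[mu]_(x in E) (\esum_(i in D) f i x) =
  \esum_(i in D) \int[mu]_(x in E) f i x.
Proof.
move=> mE mf f0; rewrite esum_series; last first.
  by move=> i Di; apply: integral_ge0 => x _; apply: f0.
under eq_integral do (rewrite esum_series; last by move=> i; apply: f0).
rewrite integral_nneseries//.
- apply: eq_eseriesr => n _; case: (@pickle_inv I n) => [i|] /=; last by rewrite integral0.
  by case: ifPn => // _; rewrite integral0.
- move=> n; case: (@pickle_inv I n) => [i|] /=; last exact: measurable_cst.
  by have [/set_mem/mf//|_] := boolP (i \in D); exact: measurable_cst.
- by move=> n x _; case: (@pickle_inv I n) => //= i; case: ifPn => // /set_mem /f0.
Qed.

Lemma integral_bigcup_esum (D : set I) (F : I -> set T) (f : T -> \bar R) :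
  (forall i, D i -> measurable (F i)) -> trivIset D F ->
  measurable_fun setT f -> (forall x, 0 <= f x) ->
  \int[mu]_(x in \bigcup_(i in D) F i) f x =
  \esum_(i in D) \int[mu]_(x in F i) f x.
Proof.
move=> mF tF mf f0; rewrite esum_series; last first.
  by move=> i Di; apply: integral_ge0 => x _; apply: f0.
pose G n := oapp (fun i => if i \in D then F i else set0) set0 (@pickle_inv I n).
have -> : \bigcup_(i in D) F i = \bigcup_n G n.
  apply/seteqP; split => x [].
    by move=> i Di Fx; exists (pickle i) => //; rewrite /G pickleK_inv /= mem_set.
  move=> n _; rewrite /G; case: (@pickle_inv I n) => //= i.
  by case: ifPn => // /set_mem Di Fx; exists i.
rewrite ge0_integral_bigcup//.
- apply: eq_eseriesr => n _; rewrite /G; case: (@pickle_inv I n) => [i|] /=.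
    by case: ifPn => // _; rewrite integral_set0.
  by rewrite integral_set0.
- move=> n; rewrite /G; case: (@pickle_inv I n) => //= i.
  by case: ifPn => // /set_mem/mF.
- by apply: measurable_funTS.
- apply/trivIsetP => n m _ _ /eqP nm; rewrite /G.
  have := @pickle_invK I n; have := @pickle_invK I m.
  case: (pickle_inv n) => [i|] /=; last by rewrite set0I.
  case: (pickle_inv m) => [j|] /=; last by rewrite setI0.
  move=> jm im; have /eqP ij : i <> j by move=> ij; apply: nm; rewrite -im -jm ij.
  case: ifPn => [/set_mem Di|_]; last by rewrite set0I.
  case: ifPn => [/set_mem Dj|_]; last by rewrite setI0.
  by move/trivIsetP : tF; apply.
Qed.

Lemma measure_bigcup_esum (D : set I) (F : I -> set T) :
  (forall i, D i -> measurable (F i)) -> trivIset D F ->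
  mu (\bigcup_(i in D) F i) = \esum_(i in D) mu (F i).
Proof.
move=> mF tF; have h (A : set T) : measurable A -> mu A = \int[mu]_(x in A) 1.
  by move=> mA; rewrite integral_cst// mul1e.
rewrite h; last by exact: measurable_bigcup_countType.
rewrite integral_bigcup_esum//.
by apply: eq_esum => i Di; rewrite h//; apply: mF.
Qed.

End countable_sums.

(** * Disintegration identities *)

Section integrals.
Local Open Scope ereal_scope.
Context (R : realType) (dT : measure_display) (T : measurableType dT).
Context (mu : {measure set T -> \bar R}).
Context (dX : measure_display) (X : measurableType dX).

(** [mu] need not be complete, so an almost sure comparison comes with an explicit measurable null
    set [N]. *)
Lemma measure_eq_off_null (N A B : set T) :
  measurable N -> mu N = 0 -> measurable A -> measurable B ->
  (forall w, ~ N w -> (A w <-> B w)) -> mu A = mu B.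
Proof.
move=> mN N0 mA mB AB.
rewrite -(measureU0 mA mN N0) -(measureU0 mB mN N0); congr (mu _).
apply/seteqP; split => w [Cw|Nw]; (try by right); have [Nw|nNw] := pselect (N w);
  by [right|left; apply/AB].
Qed.

Lemma integral_eq_off_null (N A B : set T) (f g : T -> \bar R) :
  measurable N -> mu N = 0 -> measurable A -> measurable B ->
  measurable_fun setT f -> measurable_fun setT g ->
  (forall w, 0 <= f w) -> (forall w, 0 <= g w) ->
  (forall w, ~ N w -> (A w <-> B w)) ->
  (forall w, ~ N w -> A w -> f w = g w) ->
  \int[mu]_(w in A) f w = \int[mu]_(w in B) g w.
Proof.
move=> mN N0 mA mB mf mg f0 g0 AB fg.
rewrite (@ge0_negligible_integral _ _ _ mu A N)//; last exact: measurable_funTS.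
rewrite (@ge0_negligible_integral _ _ _ mu B N)//; last exact: measurable_funTS.
have -> : B `\` N = A `\` N.
  by apply/seteqP; split => w [Cw Nw]; split => //; apply/AB.
by apply: eq_integral => w /set_mem [Aw Nw]; apply: fg.
Qed.

Import HBNNSimple.

(** Standard extension from indicators through simple functions to monotone limits. [F1] may be
    smaller than [F2]: typically [F1] is [F2] cut by the event of a step, [c] is the density of that
    step and [K] its kernel. *)
Lemma integral_disintegration (F1 F2 : set T) (a : T -> X)
    (c : T -> R) (K : T -> {measure set X -> \bar R}) (g : X -> \bar R) :
  measurable F1 -> measurable F2 -> measurable_fun setT a ->
  measurable_fun setT c -> (forall w, (0 <= c w)%R) ->
  (forall A, measurable A -> measurable_fun setT (fun w => K w A)) ->
  (forall A, measurable A ->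
    mu (F1 `&` a @^-1` A) = \int[mu]_(w in F2) ((c w)%:E * K w A)) ->
  measurable_fun setT g -> (forall x, 0 <= g x) ->
  \int[mu]_(w in F1) g (a w) = \int[mu]_(w in F2) ((c w)%:E * \int[K w]_y g y).
Proof.
move=> mF1 mF2 ma mc c0 mK h mg g0.
have ma' A : measurable A -> measurable (a @^-1` A).
  by move=> mA; rewrite -[_ @^-1` _]setTI; apply: ma.
have mcE : measurable_fun setT (fun w => (c w)%:E) by exact/measurable_EFinP.
have mKint f : measurable_fun setT f -> (forall x, 0 <= f x) ->
    measurable_fun setT (fun w => \int[K w]_y f y).
  by move=> mf f0; apply: measurable_fun_integral_kernel.
have hs (f : {nnsfun X >-> R}) : \int[mu]_(w in F1) (f (a w))%:E =
    \int[mu]_(w in F2) ((c w)%:E * \int[K w]_y (f y)%:E).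
  have mi r : measurable_fun [set: X]
      (fun y => (r * \1_(f @^-1` [set r]) y)%:E).
    by apply/measurable_EFinP; exact: measurableT_comp.
  have i0 r y : 0 <= (r * \1_(f @^-1` [set r]) y)%:E.
    by rewrite EFinM nnfun_muleindic_ge0.
  have e1 r : \int[mu]_(w in F1) (r * \1_(f @^-1` [set r]) (a w))%:E =
      \int[mu]_(w in F2) ((c w)%:E * \int[K w]_y (r * \1_(f @^-1` [set r]) y)%:E).
    have [r0|r0] := ltP r 0%R.
      rewrite !integral0_eq// => w _.
        by rewrite integral0_eq ?mule0// => y _; rewrite preimage_nnfun0 ?indic0 ?mulr0.
      by rewrite preimage_nnfun0 ?indic0 ?mulr0.
    under eq_integral do rewrite EFinM.
    rewrite ge0_integralZl//; last first.
      apply: measurable_funTS; apply/measurable_EFinP.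
      rewrite (_ : (fun x => _) = \1_(a @^-1` (f @^-1` [set r])))//.
      by apply: measurable_indic; exact: ma'.
    have -> : (fun w => (\1_(f @^-1` [set r]) (a w))%:E) =
        (fun w => (\1_(a @^-1` (f @^-1` [set r])) w)%:E :> \bar R) by [].
    rewrite integral_indic//; last exact: ma'.
    rewrite setIC h// -ge0_integralZl//; last 2 first.
    - by apply: measurable_funTS; apply: emeasurable_funM => //; exact: mK.
    - by move=> w _; rewrite mule_ge0// lee_fin.
    apply: eq_integral => w _.
    under eq_integral do rewrite EFinM.
    rewrite ge0_integralZl//; last by apply/measurable_EFinP.
    by rewrite integral_indic// setIT muleCA.
  under eq_integral do rewrite fimfunE -fsumEFin//.
  rewrite ge0_integral_fsum//; last first.
    by move=> r; apply: measurable_funTS; exact: (measurableT_comp (mi r)).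
  under [in RHS]eq_integral => w _.
    under eq_integral do rewrite fimfunE -fsumEFin//.
    rewrite ge0_integral_fsum// ge0_mule_fsumr; last first.
      by move=> r; apply: integral_ge0.
    over.
  rewrite ge0_integral_fsum//.
  - by apply: eq_fsbigr => r _; exact: e1.
  - move=> r; apply: measurable_funTS; apply: emeasurable_funM => //.
    exact: mKint.
  - by move=> r w _; rewrite mule_ge0 ?lee_fin// integral_ge0.
pose g_ := nnsfun_approx measurableT mg.
have g_0 n x : 0 <= (g_ n x)%:E by rewrite lee_fin.
have g_nd x : {homo (fun n => (g_ n x)%:E) : n m / (n <= m)%N >-> n <= m}.
  by move=> n m nm; rewrite lee_fin; exact/lefP/nd_nnsfun_approx.
have mg_ n : measurable_fun setT (fun x => (g_ n x)%:E) by exact/measurable_EFinP.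
have g_lim x : limn (fun n => (g_ n x)%:E) = g x.
  by apply/cvg_lim => //; exact: cvg_nnsfun_approx.
transitivity (\int[mu]_(w in F1) limn (fun n => (g_ n (a w))%:E)).
  by apply: eq_integral => w _; rewrite g_lim.
rewrite monotone_convergence//; last first.
  by move=> n; apply: measurable_funTS; exact: (measurableT_comp (mg_ n)).
under [X in limn X]eq_fun do rewrite hs.
rewrite -monotone_convergence//.
- apply: eq_integral => w _.
  transitivity ((c w)%:E * limn (fun n => \int[K w]_y (g_ n y)%:E)).
    rewrite limeMl//; apply: ereal_nondecreasing_is_cvgn => n m nm.
    by apply: ge0_le_integral => // y _; apply: g_nd.
  rewrite -monotone_convergence//.
  by congr (_ * _); apply: eq_integral => y _; rewrite g_lim.
- by move=> n; apply: measurable_funTS; apply: emeasurable_funM => //; exact: mKint.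
- by move=> n w _; rewrite mule_ge0 ?lee_fin// integral_ge0.
- move=> w _ n m nm; rewrite lee_pmul ?lee_fin// ?integral_ge0//.
  by apply: ge0_le_integral => // y _; apply: g_nd.
Qed.

End integrals.

(** * Lattice vectors and strict paths *)

Section vectors.
Context (d : nat).
Implicit Types (u v k h t : Nvec d) (s : Zvec d).

(** Induction measure of the restart argument: a nonzero step inside the rectangle lowers the weight
    of the residual. *)
Definition weight v : nat := (\sum_i v i)%N.

(* The paper's [u = k - S_n] on the event [S_n <= k]. *)
Definition residual k s : Nvec d := ofZ (toZ k - s)%R.

Lemma addvE k h i : (k + h)%R i = (k i + h i)%N. Proof. by rewrite ffunE. Qed.

Lemma lev_refl k : lev k k. Proof. by []. Qed.

Lemma lev_trans k u v : lev u k -> lev k v -> lev u v.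
Proof. by move=> uk kv i; apply: leq_trans (uk i) (kv i). Qed.

Lemma lev_addr k h : lev k (k + h)%R.
Proof. by move=> i; rewrite ffunE; apply: leq_addr. Qed.

Lemma lev0 v : lev v 0%R <-> v = 0%R.
Proof.
split=> [v0|->//]; apply/ffunP => i; have := v0 i.
by rewrite !ffunE leqn0 => /eqP.
Qed.

Lemma toZ_inj : injective (@toZ d).
Proof. by move=> u v /ffunP uv; apply/ffunP => i; have := uv i; rewrite !ffunE => -[]. Qed.

Lemma toZK : cancel (@toZ d) (@ofZ d).
Proof. by move=> v; apply/ffunP => i; rewrite !ffunE absz_nat. Qed.

Lemma toZ_residual k s : levZ s k -> toZ (residual k s) = (toZ k - s)%R.
Proof.
by move=> sk; apply/ffunP => i; rewrite !ffunE gez0_abs// subr_ge0.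
Qed.

Lemma levZ_residual k s v : levZ s k ->
  levZ (s + toZ v)%R k <-> lev v (residual k s).
Proof.
move=> sk; split=> h i; have := h i; have /ffunP/(_ i) := toZ_residual sk;
  rewrite !ffunE => e.
  by rewrite -lez_nat e lerBrDl.
by rewrite -lez_nat e lerBrDl.
Qed.

Lemma levZD k s v : levZ (s + toZ v)%R k -> levZ s k.
Proof.
move=> h i; have := h i; rewrite !ffunE; apply: le_trans.
by rewrite lerDl.
Qed.

Lemma residualD k s v : levZ s k -> lev v (residual k s) ->
  residual k (s + toZ v)%R = subv (residual k s) v.
Proof.
move=> sk vk; apply: toZ_inj; rewrite toZ_residual; last exact/levZ_residual.
apply/ffunP => i; have /ffunP/(_ i) := toZ_residual sk; have := vk i.
by rewrite !ffunE => vi e; rewrite -subzn// e opprD addrA.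
Qed.

Lemma residual_addn k h s : levZ s k -> residual (k + h)%R s = (residual k s + h)%R.
Proof.
move=> sk; have skh : levZ s (k + h)%R.
  by move=> i; apply: le_trans (sk i) _; rewrite lez_nat lev_addr.
apply: toZ_inj; rewrite toZ_residual//.
apply/ffunP => i; have /ffunP/(_ i) := toZ_residual sk.
by rewrite !(addvE, ffunE) => e; rewrite !PoszD e addrAC.
Qed.

Lemma levZ_opp u k : levZ (- toZ u)%R k.
Proof. by move=> i; rewrite !ffunE; lia. Qed.

Lemma residual_opp k u : residual k (- toZ u)%R = (k + u)%R.
Proof.
apply: toZ_inj; rewrite toZ_residual; last exact: levZ_opp.
by apply/ffunP => i; rewrite !(addvE, ffunE) opprK PoszD.
Qed.

(** Since [k] is nonnegative, the truncation level [- s] of the first step lies below [k - s]. A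
    first step leaving the rectangle below the residual is therefore one that the truncated kernel
    charges. *)
Lemma lev_opp_residual k s : levZ s 0%R -> lev (ofZ (- s)%R) (residual k s).
Proof.
move=> s0 i; have := s0 i; rewrite !ffunE.
have abs_le (a : int) (b : nat) : (a <= 0)%R ->
  (`|(- a)%R| <= `|(b%:Z - a)%R|)%N by lia.
exact: abs_le.
Qed.

Lemma weight_subv t v : lev v t -> v != 0%R -> (weight (subv t v) < weight t)%N.
Proof.
move=> vt v0; have [i vi] : exists i, (0 < v i)%N.
  apply/existsP; apply: contraNT v0; rewrite negb_exists => /forallP v0.
  apply/eqP/ffunP => i; rewrite ffunE; have := v0 i; rewrite -leqNgt leqn0.
  by move/eqP.
rewrite /weight (bigD1 i)//= [ltnRHS](bigD1 i)//= -addSn leq_add//.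
  by rewrite ffunE; have := vt i; lia.
by apply: leq_sum => j _; rewrite ffunE leq_subr.
Qed.

Lemma weight_eq0 v : v != 0%R -> (0 < weight v)%N.
Proof. by move=> /(weight_subv (@lev_refl v)); apply: leq_ltn_trans. Qed.

Lemma weightD u v : weight (u + v)%R = (weight u + weight v)%N.
Proof. by rewrite /weight -big_split; apply: eq_bigr => i _; rewrite ffunE. Qed.

Lemma leq_weight u v : lev u v -> (weight u <= weight v)%N.
Proof. by move=> uv; apply: leq_sum => i _; apply: uv. Qed.

End vectors.

Section paths.
Context (d : nat) (dO : measure_display) (Omega : measurableType dO).
Context (S : nat -> {mfun Omega >-> Zvec d}).
Implicit Types (k : Nvec d) (w : Omega).

(** The good event for [Ncount]: the start is nonpositive, so index 0 always qualifies, and nonzero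
    steps bound the set of indices. *)
Definition strict_path w : Prop :=
  (exists u, S 0%N w = (- toZ u)%R) /\
  forall n, exists2 v, v != 0%R & (S n.+1 w - S n w)%R = toZ v.

Lemma strict_path_levZ w k m n : strict_path w -> (m <= n)%N ->
  levZ (S n w) k -> levZ (S m w) k.
Proof.
move=> [_ inc] /subnK <-; elim: (n - m)%N => [//|j IH]; rewrite addSn => h.
have [v _ e] := inc (j + m)%N; apply: IH; apply: (@levZD d k _ v).
by rewrite -e addrC subrK.
Qed.

(** The weight of [S_n + u] grows by at least 1 at each step, while staying below [k] would cap it
    by the weight of [k + u]. *)
Lemma strict_path_unbounded w k : strict_path w -> exists n, ~ levZ (S n w) k.
Proof.
move=> [[u u0] inc].
have [f fE] : exists f : nat -> Nvec d, forall n,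
    (S n w = (toZ (f n) - toZ u)%R) /\ (n <= weight (f n))%N.
  have h n : exists v, (S n w = (toZ v - toZ u)%R) /\ (n <= weight v)%N.
    elim: n => [|n [v [e nv]]].
      exists 0%R; split => //; rewrite u0 -[LHS]add0r; congr (_ - _)%R.
      by apply/ffunP => i; rewrite !ffunE.
    have [v' v'0 e'] := inc n; exists (v + v')%R; split.
      rewrite -[LHS](subrK (S n w)) e' e addrA; congr (_ - _)%R.
      by apply/ffunP => i; rewrite !(addvE, ffunE) PoszD addrC.
    by rewrite weightD -addn1 leq_add// weight_eq0.
  by have [f ff] := choice h; exists f.
exists (weight (k + u)%R).+1 => h.
have [e lt] := fE (weight (k + u)%R).+1.
suff /leq_weight : lev (f (weight (k + u)%R).+1) (k + u)%R by rewrite leqNgt lt.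
move=> i; have := h i; rewrite e !(addvE, ffunE); lia.
Qed.

Lemma Ncount_unique w k n : strict_path w ->
  levZ (S n w) k -> ~ levZ (S n.+1 w) k -> Ncount S k w = n.
Proof.
move=> sw h1 h2; rewrite /Ncount; set Q := [set _ | _].
have Qn : Q n.
  split=> // m h; rewrite leqNgt; apply/negP => nm; apply: h2.
  exact: strict_path_levZ nm h.
have [Q1 Q2] := xgetPex 0%N (ex_intro _ _ Qn); apply/eqP.
by rewrite eqn_leq Qn.2// Q2.
Qed.

Lemma Ncount_spec w k : strict_path w ->
  levZ (S (Ncount S k w) w) k /\ ~ levZ (S (Ncount S k w).+1 w) k.
Proof.
move=> sw; have [n nk] := strict_path_unbounded k sw.
have [n0 [h1 h2]] : exists n, levZ (S n w) k /\ ~ levZ (S n.+1 w) k.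
  elim: n nk => [|n IH] nk.
    by case: sw => -[u u0] _; exfalso; apply: nk; rewrite u0; exact: levZ_opp.
  have [h|/IH//] := pselect (levZ (S n w) k); by exists n.
by rewrite (Ncount_unique sw h1 h2).
Qed.

End paths.

(** * Tails of the renewal kernel *)

Section renewal_kernels.
Local Open Scope ereal_scope.
Context (R : realType) (d : nat) (dX : measure_display) (X : measurableType dX).
Variable q : Nvec d -> R.-ker X ~> X.

Lemma Hbar_ge0 u x : 0 <= Hbar q u x. Proof. exact: esum_ge0. Qed.

Lemma measurable_Hbar u : measurable_fun setT (Hbar q u).
Proof. by apply: measurable_esum => // v _; apply: measurable_kernel. Qed.

Lemma ker_le_Hbar u v x A : measurable A -> ~ lev v u -> q v x A <= Hbar q u x.
Proof.
move=> mA vu; apply: (@le_trans _ _ (q v x setT)).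
  by apply: le_measure; rewrite ?inE.
rewrite -(@esum_set1 _ _ v (fun v => q v x setT))//.
rewrite /Hbar esum_mkcond [leRHS]esum_mkcond; apply: le_esum => w _.
by case: ifPn => [/set_mem ->|_]; [rewrite mem_set//|case: ifPn].
Qed.

Lemma esum_q_eq0 u x (D : set (Nvec d)) : Hbar q u x = 0 ->
  (forall v, D v -> ~ lev v u) -> \esum_(v in D) q v x setT = 0.
Proof.
move=> H0 Du; apply: esum1 => v /Du vu; apply/eqP.
by rewrite eq_le measure_ge0 andbT -H0 ker_le_Hbar.
Qed.

(** A real-valued inverse, equal to 0 where the tail vanishes, so that it can serve as the density
    [c] in [integral_disintegration]. *)
Definition Hinv u x : R := (fine (Hbar q u x))^-1%R.

Lemma measurable_Hinv u : measurable_fun setT (Hinv u).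
Proof.
have -> : Hinv u = (@powR R)^~ (-1)%R \o (fine \o Hbar q u).
  by apply/funext => x; rewrite /= powR_inv1// fine_ge0// Hbar_ge0.
apply: measurableT_comp; first exact: measurable_powR.
by apply: measurableT_comp; [exact: fine_measurable|exact: measurable_Hbar].
Qed.

Lemma Hinv_ge0 u x : (0 <= Hinv u x)%R.
Proof. by rewrite invr_ge0 fine_ge0// Hbar_ge0. Qed.

Hypothesis hq : renewal_kernel q.

Lemma Hbar_le1 u x : Hbar q u x <= 1.
Proof.
rewrite -(hq x) /Hbar esum_mkcond; apply: le_esum => v _.
by case: ifPn.
Qed.

Lemma Hbar_fin u x : Hbar q u x \is a fin_num.
Proof. by rewrite ge0_fin_numE ?Hbar_ge0// (le_lt_trans (Hbar_le1 u x)) ?ltry. Qed.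

Lemma Hinv_Hbar u x : 0 < Hbar q u x -> (Hinv u x)%:E * Hbar q u x = 1.
Proof.
move=> H0; rewrite /Hinv -[in X in _ * X](fineK (Hbar_fin u x)) -EFinM mulVf//.
by rewrite gt_eqF// fine_gt0// H0 ltey_eq Hbar_fin.
Qed.

Lemma inve_Hbar u x : 0 < Hbar q u x -> (Hbar q u x)^-1 = (Hinv u x)%:E.
Proof.
move=> H0; rewrite /Hinv -[in LHS](fineK (Hbar_fin u x)) inver.
by rewrite gt_eqF// fine_gt0// H0 ltey_eq Hbar_fin.
Qed.

(** Where the tail vanishes, every [q v x A] with [v] outside the rectangle vanishes too, so the
    value chosen for the inverse of 0 does not matter. *)
Lemma qtruncE u v x A : measurable A ->
  qtrunc q u v x A =
  if `[< lev v u >] then 0 else (Hinv u x)%:E * q v x A.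
Proof.
move=> mA; rewrite /qtrunc; case: asboolP => // vu.
have := Hbar_ge0 u x; rewrite le_eqVlt => /predU1P[H0|H0].
  suff -> : q v x A = 0 by rewrite mul0e mule0.
  by apply/eqP; rewrite eq_le measure_ge0 andbT H0 ker_le_Hbar.
by rewrite inve_Hbar// muleC.
Qed.

Hypothesis hstrict : strict_kernel q.

(** Only [v = 0] lies below 0, and it carries no mass. An ordinary step is thus a step truncated at
    level 0. *)
Lemma Hbar0 x : Hbar q 0%R x = 1.
Proof.
rewrite -(hq x) /Hbar esum_mkcond; apply: eq_esum => v _.
case: ifPn => // /negP v0; have -> : v = 0%R.
  by apply/lev0; apply: contrapT => v0'; apply: v0; apply/mem_set.
by rewrite hstrict.
Qed.

Lemma Espace0 x : Espace q (x, 0%R).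
Proof. by rewrite /Espace /= Hbar0. Qed.

End renewal_kernels.

(** * The history of the chain *)

Section past.
Context (d : nat) (dO : measure_display) (Omega : measurableType dO).
Context (dX : measure_display) (X : measurableType dX).
Context (J : nat -> {mfun Omega >-> X}) (S : nat -> {mfun Omega >-> Zvec d}).
Implicit Types (k : Nvec d) (F : set Omega).

Definition past_gen n : set (set Omega) :=
  \bigcup_(m in [set m | (m <= n)%N])
    (preimage_set_system setT (J m) measurable `|`
     preimage_set_system setT (S m) measurable).

(** A copy of [Omega] whose measurable sets are, by conversion, the events of the past; closure
    properties then come from [measurableI] and the like. *)
Definition past_space n := g_sigma_algebraType (past_gen n).

Lemma sigma_pastE n : sigma_past J S n = @measurable _ (past_space n).
Proof. by []. Qed.

Lemma measurable_J n A : measurable A -> measurable (J n @^-1` A).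
Proof. by move=> mA; rewrite -[_ @^-1` _]setTI; exact: measurable_funPT. Qed.

Lemma measurable_S n (B : set (Zvec d)) : measurable (S n @^-1` B).
Proof. by rewrite -[_ @^-1` _]setTI; exact: measurable_funPT. Qed.

Lemma past_measurable n F : sigma_past J S n F -> measurable F.
Proof.
apply: smallest_sub; first exact: sigma_algebra_measurable.
move=> _ [m _ [[A mA <-]|[A mA <-]]]; rewrite setTI.
  exact: measurable_J.
exact: measurable_S.
Qed.

Lemma past_J n m A : (m <= n)%N -> measurable A ->
  sigma_past J S n (J m @^-1` A).
Proof.
move=> mn mA; apply: sub_gen_smallest; exists m => //; left.
by exists A => //; rewrite setTI.
Qed.

Lemma past_S n m (B : set (Zvec d)) : (m <= n)%N ->
  sigma_past J S n (S m @^-1` B).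
Proof.
move=> mn; apply: sub_gen_smallest; exists m => //; right.
by exists B => //; rewrite setTI.
Qed.

Lemma past_mono n m F : (n <= m)%N -> sigma_past J S n F -> sigma_past J S m F.
Proof.
move=> nm; apply: smallest_sub; first exact: smallest_sigma_algebra.
move=> _ [j jn [[A mA <-]|[A mA <-]]]; rewrite setTI.
  by apply: past_J => //; exact: leq_trans nm.
by apply: past_S; exact: leq_trans nm.
Qed.

Definition step n (v : Nvec d) (A : set X) : set Omega :=
  [set w | A (J n.+1 w) /\ (S n.+1 w - S n w)%R = toZ v].

Lemma past_step n v A : measurable A -> sigma_past J S n.+1 (step n v A).
Proof.
move=> mA; have -> : step n v A = J n.+1 @^-1` A `&`
    [set w | (S n.+1 w - S n w)%R = toZ v] by [].
rewrite sigma_pastE; apply: measurableI; first exact: past_J.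
by apply: (@measurable_discrete_rel _ _ (past_space n.+1) (S n.+1) (S n)
  (fun a b => (a - b)%R = toZ v)) => B; exact: past_S.
Qed.

Lemma measurable_step n v A : measurable A -> measurable (step n v A).
Proof. by move=> mA; apply: (@past_measurable n.+1); exact: past_step. Qed.

Lemma trivIset_step n (D : set (Nvec d)) (A : Nvec d -> set X) :
  trivIset D (fun v => step n v (A v)).
Proof.
apply/trivIsetP => u v _ _ /eqP uv; rewrite -subset0 => w [[_ e1] [_ e2]].
by apply: uv; apply: toZ_inj; rewrite -e1 -e2.
Qed.

Lemma measurable_Ncount k n : measurable [set w | Ncount S k w = n].
Proof.
pose Q n := [set w | levZ (S n w) k /\ forall m, levZ (S m w) k -> (m <= n)%N].
have mQ i : measurable (Q i).
  rewrite (_ : Q i = S i @^-1` [set s | levZ s k] `&`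
      \bigcap_m (S m @^-1` [set s | levZ s k -> (m <= i)%N])).
    apply: measurableI; first exact: measurable_S.
    by apply: bigcapT_measurable => m; exact: measurable_S.
  by apply/seteqP; split => w [h1 h2]; split => // m; [move=> _ /h2|exact: h2].
have uQ w i : Q i w -> Ncount S k w = i.
  move=> Qi; have [h1 h2] : Q (Ncount S k w) w :=
    xgetPex 0%N (ex_intro (fun n => Q n w) i Qi).
  by apply/eqP; rewrite eqn_leq Qi.2// h2//; case: Qi.
have QN w : Ncount S k w <> 0%N -> Q (Ncount S k w) w.
  case: (pselect (exists n, Q n w)) => [[i Qi] _|h []]; first by rewrite (uQ _ _ Qi).
  by apply: xgetPN => m Qm; apply: h; exists m.
have e i : [set w | Ncount S k w = i.+1] = Q i.+1.
  by apply/seteqP; split => [w /= wi|w /uQ//]; rewrite -wi; apply: QN; rewrite wi.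
(* The value 0 also collects the paths without a maximum, where [xget] returns its default, so it is
   reached as a complement. *)
case: n => [|n]; last by rewrite e.
rewrite (_ : [set w | _] = ~` \bigcup_n Q n.+1).
  by apply: measurableC; apply: bigcupT_measurable => m.
apply/seteqP; split => [w w0 [m _ /uQ]|w h]; first by rewrite w0.
case E : (Ncount S k w) => [|m]; first exact: E.
by exfalso; apply: h; exists m => //; rewrite -e.
Qed.

Lemma measurable_Zfield k : measurable_fun setT (Zfield J S k).
Proof.
move=> _ A mA; rewrite setTI (_ : _ @^-1` _ =
    \bigcup_n ([set w | Ncount S k w = n] `&` J n @^-1` A)).
  apply: bigcupT_measurable => n; apply: measurableI; last exact: measurable_J.
  exact: measurable_Ncount.
apply/seteqP; split => [w Aw|w [n _ [/= <- //]]].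
by exists (Ncount S k w).
Qed.

Lemma measurable_Zpre k A : measurable A -> measurable (Zfield J S k @^-1` A).
Proof. by move=> mA; rewrite -[_ @^-1` _]setTI; exact: measurable_Zfield. Qed.

End past.

(** * One step of a renewal process *)

Section flow.
Local Open Scope ereal_scope.
Context (R : realType) (d : nat) (dX : measure_display) (X : measurableType dX).
Variable q : Nvec d -> R.-ker X ~> X.
Hypothesis hq : renewal_kernel q.
Hypothesis hstrict : strict_kernel q.
Context (dO : measure_display) (Omega : measurableType dO).
Context (J : nat -> {mfun Omega >-> X}) (S : nat -> {mfun Omega >-> Zvec d}).
Implicit Types (P : {measure set Omega -> \bar R}) (F : set Omega) (n : nat).

(* Common to the field started from a law on [Espace] and to the chain started
   from a point: both only enter through these set identities. *)
Definition renewal_flow P : Prop :=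
  [/\ P setT = 1,
      {ae P, forall w, exists2 u, S 0%N w = (- toZ u)%R & Espace q (J 0%N w, u)},
      forall s v A F, measurable A -> sigma_past J S 0 F ->
        F `<=` S 0%N @^-1` [set s] ->
        P (F `&` step J S 0 v A) =
        \int[P]_(w in F) qtrunc q (ofZ (- s)%R) v (J 0%N w) A
    & forall n v A F, (1 <= n)%N -> measurable A -> sigma_past J S n F ->
        P (F `&` step J S n v A) = \int[P]_(w in F) q v (J n w) A].

(** Density of step [n] with respect to [q] on the slice [S_n = s]: only the first step is
    renormalised. *)
Definition step_weight n (s : Zvec d) (x : X) : R :=
  if n is 0 then Hinv q (ofZ (- s)%R) x else 1%R.

Lemma measurable_step_weight n s : measurable_fun setT (step_weight n s).
Proof. by case: n => [|n]; [exact: measurable_Hinv|exact: measurable_cst]. Qed.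

Lemma step_weight_ge0 n s x : (0 <= step_weight n s x)%R.
Proof. by case: n => [|n] //=; exact: Hinv_ge0. Qed.

(* The first step is known to leave the rectangle below this vector. *)
Definition exit_level n (s : Zvec d) : Nvec d := if n is 0 then ofZ (- s)%R else 0%R.

Definition jump n (u : Nvec d) : set Omega :=
  \bigcup_(v in [set v | ~ lev v u]) step J S n v setT.

Lemma measurable_jump n u : measurable (jump n u).
Proof. by apply: measurable_bigcup_countType => v _; exact: measurable_step. Qed.

Section fixed_law.
Variable P : {measure set Omega -> \bar R}.
Hypothesis flowP : renewal_flow P.

Lemma flow_step n s v A F : measurable A -> sigma_past J S n F ->
  F `<=` S n @^-1` [set s] -> (n = 0%N -> ~ lev v (ofZ (- s)%R)) ->
  P (F `&` step J S n v A) =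
  \int[P]_(w in F) ((step_weight n s (J n w))%:E * q v (J n w) A).
Proof.
case: flowP => _ _ P0 P1 mA pF Fs; case: n pF Fs => [|n] pF Fs h.
  rewrite (P0 s)//; apply: eq_integral => w _.
  by rewrite qtruncE//; case: asboolP => // /(h erefl).
by rewrite P1//; apply: eq_integral => w _; rewrite mul1e.
Qed.

Let mcomp n (f : X -> \bar R) : measurable_fun setT f ->
  measurable_fun setT (fun w => f (J n w)).
Proof. by move=> mf; exact: measurableT_comp. Qed.

Let msw n s : measurable_fun setT (fun w => (step_weight n s (J n w))%:E).
Proof.
apply/measurable_EFinP; apply: (measurableT_comp (measurable_step_weight n s)).
exact: measurable_funPT.
Qed.

(** The level condition at time 0 puts every [v] outside [u] beyond the truncation, so each such
    step has the weighted kernel as its law; their sum is the tail. *)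
Lemma flow_jump n s u F : sigma_past J S n F ->
  F `<=` S n @^-1` [set s] -> (n = 0%N -> lev (ofZ (- s)%R) u) ->
  P (F `&` jump n u) =
  \int[P]_(w in F) ((step_weight n s (J n w))%:E * Hbar q u (J n w)).
Proof.
move=> pF Fs h; have mF := past_measurable pF.
rewrite /jump setI_bigcupr measure_bigcup_esum; last 2 first.
- by move=> v _; apply: measurableI => //; exact: measurable_step.
- by apply: trivIset_setIl; exact: trivIset_step.
under eq_esum => v vu.
  rewrite (flow_step _ pF Fs)//; last first.
    by move=> n0 vs; apply: vu; apply: lev_trans vs _; exact: h.
  over.
rewrite -integral_esum//.
- by apply: eq_integral => w _; rewrite esumZl// step_weight_ge0.
- move=> v _; apply: measurable_funTS; apply: emeasurable_funM => //.
  exact: (mcomp _ (measurable_kernel (q v) _ measurableT)).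
- by move=> v w _; rewrite mule_ge0// lee_fin step_weight_ge0.
Qed.

(** On a slice [S_n = s] the jump keeps the whole mass, because weight times tail is 1: at time 0
    since the start almost surely lies in [Espace], later since the tail at level 0 is 1. There are
    countably many slices. *)
Lemma flow_ae_jump n : {ae P, forall w, jump n (exit_level n (S n w)) w}.
Proof.
case: flowP => PT Pinit _ _.
pose F s := S n @^-1` [set s].
have h s : P (F s `\` jump n (exit_level n s)) = 0.
  have pF : sigma_past J S n (F s) by exact: past_S.
  have mF : measurable (F s) by exact: measurable_S.
  have mj := measurable_jump n (exit_level n s).
  have PF : P (F s `&` jump n (exit_level n s)) = P (F s).
    rewrite (flow_jump (s := s) pF)//; last by move=> ->.
    rewrite -[RHS]mul1e -(integral_cst P mF).
    case: Pinit => N [mN N0 Ninit].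
    apply: (integral_eq_off_null mN N0) => //.
    - by apply: emeasurable_funM => //; apply: mcomp; exact: measurable_Hbar.
    - by move=> w; rewrite mule_ge0 ?lee_fin ?step_weight_ge0// Hbar_ge0.
    - move=> w Nw; rewrite /F /exit_level /step_weight /preimage /=.
      case: (n) => [|m] Fw; last by rewrite mul1e Hbar0.
      apply: Hinv_Hbar => //.
      have [u e Eu] : exists2 u, S 0%N w = (- toZ u)%R & Espace q (J 0%N w, u).
        by apply: contrapT => c; apply: Nw; apply: Ninit.
      by rewrite -Fw e opprK toZK.
  have Ffin : P (F s) < +oo.
    apply: (@le_lt_trans _ _ (P setT)); last by rewrite PT ltry.
    by apply: le_measure; rewrite ?inE.
  have -> : P (F s `\` jump n (exit_level n s)) =
      P (F s) - P (F s `&` jump n (exit_level n s)) by exact: measureD.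
  by rewrite PF subee// ge0_fin_numE.
exists (\bigcup_(s in setT) (F s `\` jump n (exit_level n s))); split.
- apply: measurable_bigcup_countType => s _; apply: measurableD.
    exact: measurable_S.
  exact: measurable_jump.
- rewrite measure_bigcup_esum.
  + by apply: esum1.
  + move=> s _; apply: measurableD; first exact: measurable_S.
    exact: measurable_jump.
  + apply/trivIsetP => s s' _ _ /eqP ss'; rewrite -subset0 => w [[e _] [e' _]].
    by apply: ss'; rewrite -[s]e -[s']e'.
- by move=> w /= nw; exists (S n w).
Qed.

Lemma flow_ae_step n :
  {ae P, forall w, exists2 v, v != 0%R & (S n.+1 w - S n w)%R = toZ v}.
Proof.
apply: filterS (flow_ae_jump n) => w [v /= vu [_ e]]; exists v => //.
by apply/eqP => v0; apply: vu; rewrite v0 => i; rewrite ffunE.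
Qed.

Lemma flow_strict_path : {ae P, forall w, strict_path S w}.
Proof.
case: flowP => _ Pinit _ _.
apply: filterS2 Pinit (ae_foralln flow_ae_step) => w [u Su _] h.
by split=> //; exists u.
Qed.

(** Numerator of [Rker] on a cylinder, before division by the tail at [u]. The continuation [g]
    stays abstract until the induction supplies the chain law. *)
Definition step_target (A : set X) (u t : Nvec d) (g : Nvec d -> X -> \bar R)
    (x : X) : \bar R :=
  Hbar q t x * (\1_A x)%:E +
  \esum_(v in [set v | lev v t /\ ~ lev v u]) \int[q v x]_y g v y.

(** The jump is split by its value [v]. If [v] fits in the residual, the assumption on [g] takes
    over at time [n + 1]; otherwise step [n] is the last renewal below [k] and the field at [k]
    equals [J_n]. *)
Lemma first_step n s k u F A (g : Nvec d -> X -> \bar R) :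
  measurable A -> sigma_past J S n F -> F `<=` S n @^-1` [set s] ->
  (n = 0%N -> lev (ofZ (- s)%R) u) ->
  levZ s k -> lev u (residual k s) ->
  (forall v, measurable_fun setT (g v)) -> (forall v x, 0 <= g v x) ->
  (forall v F', lev v (residual k s) -> ~ lev v u -> sigma_past J S n.+1 F' ->
     F' `<=` S n.+1 @^-1` [set (s + toZ v)%R] ->
     P (F' `&` Zfield J S k @^-1` A) = \int[P]_(w in F') g v (J n.+1 w)) ->
  P ((F `&` jump n u) `&` Zfield J S k @^-1` A) =
  \int[P]_(w in F) ((step_weight n s (J n w))%:E *
                    step_target A u (residual k s) g (J n w)).
Proof.
move=> mA pF Fs h sk; set t := residual k s => ut mg g0 IH.
have mF := past_measurable pF.
have mZA := @measurable_Zpre _ _ _ _ _ J S k A mA.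
have mstep v B : measurable B -> measurable (F `&` step J S n v B).
  by move=> mB; apply: measurableI => //; exact: measurable_step.
pose phi v x := if `[< lev v t >] then \int[q v x]_y g v y
                else (\1_A x)%:E * q v x setT.
have phi0 v x : 0 <= phi v x.
  rewrite /phi; case: asboolP => _; first by apply: integral_ge0.
  by rewrite mule_ge0// lee_fin.
have mphi v : measurable_fun setT (phi v).
  rewrite /phi; case: asboolP => _.
    by apply: measurable_fun_integral_kernel => // U mU; exact: measurable_kernel.
  apply: emeasurable_funM; last exact: measurable_kernel.
  by apply/measurable_EFinP; exact: measurable_indic.
have stepE v : ~ lev v u -> P (F `&` step J S n v setT `&` Zfield J S k @^-1` A) =
    \int[P]_(w in F) ((step_weight n s (J n w))%:E * phi v (J n w)).
  move=> vu; have nv : n = 0%N -> ~ lev v (ofZ (- s)%R).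
    by move=> n0 vs; apply: vu; apply: lev_trans vs _; exact: h.
  rewrite /phi; case: asboolP => vt.
    rewrite (IH v)//.
    - apply: integral_disintegration => //.
      + exact: mstep.
      + exact: (measurableT_comp (measurable_step_weight n s)).
      + by move=> w; exact: step_weight_ge0.
      + by move=> B mB; exact: (mcomp _ (measurable_kernel (q v) _ mB)).
      + move=> B mB; rewrite -(flow_step mB pF Fs nv); congr (P _).
        by apply/seteqP; split => [w [[Fw [_ e]] Bw]|w [Fw [Bw e]]].
    - rewrite sigma_pastE; apply: measurableI; last exact: past_step.
      by apply: past_mono pF.
    - by move=> w [/Fs /= e [_]]; rewrite /preimage /= => /eqP; rewrite e subr_eq addrC => /eqP.
  (* Now [v] overshoots the residual, so [Ncount] equals [n] off a null set and the event on the
     field becomes an event on [J_n], which belongs to the past. *)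
  case: flow_strict_path => N [mN N0 Npath].
  transitivity (P ((F `&` J n @^-1` A) `&` step J S n v setT)).
    apply: (measure_eq_off_null mN N0).
    - by apply: measurableI => //; exact: mstep.
    - apply: measurableI; last exact: measurable_step.
      by apply: measurableI => //; exact: measurable_J.
    - move=> w Nw; have sw : strict_path S w.
        by apply: contrapT => c; apply: Nw; apply: Npath.
      have ZE : F w -> step J S n v setT w -> Zfield J S k w = J n w.
        move=> /Fs /= e [_ e2]; rewrite /Zfield (Ncount_unique sw (n := n))//.
          by rewrite e.
        move: e2 => /eqP; rewrite e subr_eq addrC => /eqP ->.
        by move/(levZ_residual _ sk).
      split=> [[[Fw stw] Aw]|[[Fw Aw] stw]]; split => //.
        by split=> //; rewrite /preimage /= -ZE.
      by rewrite /preimage /= ZE.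
  rewrite (flow_step (s := s))//; last 2 first.
  - rewrite sigma_pastE; apply: measurableI => //.
    exact: past_J.
  - by move=> w [/Fs].
  rewrite integral_mkcondr; apply: eq_integral => w _.
  rewrite /patch; case: ifPn => /=.
    by move=> /set_mem Aw; rewrite indicE mem_set// mul1e.
  by move=> /negP nA; rewrite indicE memNset ?mul0e ?mule0// => Aw; apply: nA; exact: mem_set.
rewrite /jump setI_bigcupr setI_bigcupl measure_bigcup_esum; last 2 first.
- by move=> v _; apply: measurableI => //; exact: mstep.
- by apply: trivIset_setIr; apply: trivIset_setIl; exact: trivIset_step.
rewrite (eq_esum stepE) -integral_esum//; last 2 first.
- move=> v _; apply: measurable_funTS; apply: emeasurable_funM => //.
  exact: (mcomp _ (mphi v)).
- by move=> v w _; rewrite mule_ge0// lee_fin step_weight_ge0.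
apply: eq_integral => w _; rewrite esumZl//; last exact: step_weight_ge0.
congr (_ * _); rewrite (esumID [set v | lev v t]); last by move=> v _.
rewrite addeC /step_target; congr (_ + _).
  rewrite muleC [Hbar _ _ _](_ : _ = \esum_(v in [set v | ~ lev v t]) q v (J n w) setT)//.
  rewrite -esumZl//.
  have -> : [set v | ~ lev v u] `&` ~` [set v | lev v t] = [set v | ~ lev v t].
    apply/seteqP; split => [v []//|v vt]; split=> // vu; apply: vt.
    exact: lev_trans ut.
  by apply: eq_esum => v /= vt; rewrite /phi; case: asboolP.
have -> : [set v | ~ lev v u] `&` [set v | lev v t] = [set v | lev v t /\ ~ lev v u].
  by apply/seteqP; split => v [].
by apply: eq_esum => v /= [vt _]; rewrite /phi; case: asboolP.
Qed.

End fixed_law.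
End flow.

(** * Chains and fields as renewal flows *)

Section chain.
Local Open Scope ereal_scope.
Context (R : realType) (d : nat) (dX : measure_display) (X : measurableType dX).
Variable q : Nvec d -> R.-ker X ~> X.
Hypothesis hq : renewal_kernel q.
Hypothesis hstrict : strict_kernel q.

Section transitions.
Context (dO : measure_display) (Omega : measurableType dO).
Context (J : nat -> {mfun Omega >-> X}) (S : nat -> {mfun Omega >-> Zvec d}).

Lemma transition_step (P : {measure set Omega -> \bar R}) n kappa v A F :
  transition J S P n kappa -> measurable A -> sigma_past J S n F ->
  P (F `&` step J S n v A) = \int[P]_(w in F) kappa w v A.
Proof.
move=> tr mA pF; have [_ _ _ ->//] := tr v A mA.
have mF := past_measurable pF.
rewrite -[X in \int[P]_(w in F) (\1_X w)%:E]/(step J S n v A).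
by rewrite integral_indic// 1?setIC//; exact: measurable_step.
Qed.

Lemma measurable_qtrunc u v A : measurable A ->
  measurable_fun setT (fun x => qtrunc q u v x A).
Proof.
move=> mA; under eq_fun do rewrite (qtruncE hq)//.
case: asboolP => _; first exact: measurable_cst.
apply: emeasurable_funM; last exact: measurable_kernel.
by apply/measurable_EFinP; exact: measurable_Hinv.
Qed.

Lemma qtrunc0 v x A : measurable A -> qtrunc q 0%R v x A = q v x A.
Proof.
move=> mA; rewrite /qtrunc; case: asboolP => [/lev0 ->|_].
  by rewrite hstrict.
by rewrite Hbar0// inve1 mule1.
Qed.

Lemma qtrunc_ge0 u v x A : 0 <= qtrunc q u v x A.
Proof.
rewrite /qtrunc; case: asboolP => // _.
by rewrite mule_ge0// inve_ge0 Hbar_ge0.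
Qed.

(** The chain is the field with [u = 0]: by strictness, truncation at level 0 leaves [q]
    unchanged. *)
Lemma chain_flow (P : {measure set Omega -> \bar R}) y :
  P setT = 1 -> renewal_chain_from q J S P y -> renewal_flow q J S P.
Proof.
move=> PT [Pinit tr]; split => //.
- apply: filterS Pinit => w [-> ->]; exists 0%R; last exact: Espace0.
  by apply/ffunP => i; rewrite !ffunE.
- move=> s v A F mA pF Fs; rewrite (transition_step v (tr 0%N) mA pF).
  have mF := past_measurable pF; case: Pinit => N [mN N0 Ninit].
  apply: (integral_eq_off_null mN N0) => //.
  + exact: (measurableT_comp (measurable_kernel (q v) _ mA)).
  + exact: (measurableT_comp (measurable_qtrunc _ _ mA)).
  + by move=> w; exact: qtrunc_ge0.
  + move=> w Nw /Fs /= <-; rewrite -(qtrunc0 v _ mA); congr qtrunc.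
    have [_ ->] : J 0%N w = y /\ S 0%N w = 0%R.
      by apply: contrapT => c; apply: Nw; apply: Ninit.
    by apply/ffunP => i; rewrite !ffunE.
- by move=> n v A F _ mA pF; rewrite (transition_step v (tr n) mA pF).
Qed.

Lemma field_flow (P : {measure set Omega -> \bar R})
    (mu : probability (X * Nvec d)%type R) :
  P setT = 1 -> mu (Espace q) = 1 -> renewal_field_from q J S P mu ->
  renewal_flow q J S P.
Proof.
move=> PT muE [init tr0 tr]; split => //.
(* The initial law is given on slices with fixed [u], so the event of starting in [Espace] is
   assembled over the countably many [u]. *)
- pose Eu u := [set x | Espace q (x, u)].
  have mEu u : measurable (Eu u).
    rewrite (_ : Eu u = Hbar q u @^-1` [set y | 0 < y]).
      rewrite -[_ @^-1` _]setTI; apply: measurable_Hbar => //.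
      by rewrite -set_itvoy; exact: emeasurable_itv.
    by [].
  pose D u := [set w | Eu u (J 0%N w) /\ S 0%N w = (- toZ u)%R].
  have mD u : measurable (D u).
    by apply: measurableI; [exact: measurable_J|exact: (measurable_S S 0 [set (- toZ u)%R])].
  have tD : trivIset setT D.
    apply/trivIsetP => u v _ _ /eqP uv; rewrite -subset0 => w [[_ e1] [_ e2]].
    by apply: uv; apply: toZ_inj; apply: oppr_inj; rewrite -e1 -e2.
  have PD : P (\bigcup_u D u) = 1.
    rewrite measure_bigcup_esum// -muE.
    have -> : Espace q = \bigcup_(u in setT) (Eu u `*` [set u]).
      apply/seteqP; split => [[x u] Ex|[x u] [v _ [/= Ex ->]]//].
      by exists u.
    rewrite measure_bigcup_esum//.
    + by apply: eq_esum => u _; apply: init.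
    + by move=> u _; apply: measurableX.
    + apply/trivIsetP => u v _ _ /eqP uv; rewrite -subset0 => -[x w] [[_ e1] [_ e2]].
      by apply: uv; rewrite -[u]e1 -[v]e2.
  have mUD : measurable (\bigcup_u D u) by apply: measurable_bigcup_countType.
  exists (~` \bigcup_u D u); split.
  + exact: measurableC.
  + rewrite -setTD.
    have -> : P (setT `\` \bigcup_u D u) = P setT - P (setT `&` \bigcup_u D u).
      have PToo : P setT < +oo by rewrite PT ltry.
      exact: measureD.
    by rewrite setTI PT PD subee.
  + move=> w nw [u _ [Ex e]]; apply: nw; by exists u.
- move=> s v A F mA pF Fs; rewrite (transition_step v tr0 mA pF).
  by apply: eq_integral => w /set_mem/Fs ->.
- by move=> n v A F n1 mA pF; rewrite (transition_step v (tr n n1) mA pF).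
Qed.

End transitions.

End chain.

(** * Restarting the chain *)

Section restart.
Local Open Scope ereal_scope.
Context (R : realType) (d : nat) (dX : measure_display) (X : measurableType dX).
Variable q : Nvec d -> R.-ker X ~> X.
Hypothesis hq : renewal_kernel q.
Hypothesis hstrict : strict_kernel q.
Context (dO : measure_display) (Omega : measurableType dO).
Variables (Py : R.-pker X ~> Omega)
  (J : nat -> {mfun Omega >-> X}) (S : nat -> {mfun Omega >-> Zvec d}).
Hypothesis hPy : forall y : X, renewal_chain_from q J S (Py y) y.

(** This is [Kker t y] on the cylinder over [A]. *)
Definition chain_law t (A : set X) (y : X) : \bar R :=
  Py y (Zfield J S t @^-1` A).

Definition chain_residual (A : set X) t (v : Nvec d) : X -> \bar R :=
  chain_law (subv t v) A.

Lemma measurable_chain_law t A : measurable A ->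
  measurable_fun setT (chain_law t A).
Proof. by move=> mA; apply: measurable_kernel; exact: measurable_Zpre. Qed.

Lemma chain_law_ge0 t A y : 0 <= chain_law t A y.
Proof. exact: measure_ge0. Qed.

Lemma measurable_step_target A u t : measurable A ->
  measurable_fun setT (step_target q A u t (chain_residual A t)).
Proof.
move=> mA; apply: emeasurable_funD.
  apply: emeasurable_funM; first exact: measurable_Hbar.
  by apply/measurable_EFinP; exact: measurable_indic.
apply: measurable_esum => [v _|v x _]; last first.
  by apply: integral_ge0 => y _; exact: chain_law_ge0.
apply: measurable_fun_integral_kernel.
- by move=> U mU; exact: measurable_kernel.
- by move=> y; exact: chain_law_ge0.
- exact: measurable_chain_law.
Qed.

Lemma step_target_ge0 A u t x :
  0 <= step_target q A u t (chain_residual A t) x.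
Proof.
apply: adde_ge0; first by rewrite mule_ge0 ?Hbar_ge0// lee_fin.
apply: esum_ge0 => v _; apply: integral_ge0 => y _; exact: chain_law_ge0.
Qed.

Lemma Py_flow y : renewal_flow q J S (Py y).
Proof. by apply: chain_flow (hPy y) => //; exact: prob_kernel. Qed.

(** The quantification over all spaces and flows lets one induction hypothesis serve both the given
    flow and the chain under [Py]. Times start at [n + 1] because the truncation affects step 0
    only. *)
Definition restarts t : Prop :=
  forall (dO' : measure_display) (Omega' : measurableType dO')
    (J' : nat -> {mfun Omega' >-> X}) (S' : nat -> {mfun Omega' >-> Zvec d})
    (P : {measure set Omega' -> \bar R}),
  renewal_flow q J' S' P ->
  forall n s k F A, levZ s k -> residual k s = t -> sigma_past J' S' n.+1 F ->
    F `<=` S' n.+1 @^-1` [set s] -> measurable A ->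
  P (F `&` Zfield J' S' k @^-1` A) =
  \int[P]_(w in F) chain_law t A (J' n.+1 w).

Section one_step.
Context (dO' : measure_display) (Omega' : measurableType dO')
  (J' : nat -> {mfun Omega' >-> X}) (S' : nat -> {mfun Omega' >-> Zvec d})
  (P : {measure set Omega' -> \bar R}).
Hypothesis flowP : renewal_flow q J' S' P.

Lemma restarts_step t n s k u F A :
  (forall t', (weight t' < weight t)%N -> restarts t') ->
  measurable A -> sigma_past J' S' n F -> F `<=` S' n @^-1` [set s] ->
  (n = 0%N -> lev (ofZ (- s)%R) u) ->
  levZ s k -> residual k s = t -> lev u t ->
  P ((F `&` jump J' S' n u) `&` Zfield J' S' k @^-1` A) =
  \int[P]_(w in F) ((step_weight q n s (J' n w))%:E *
                    step_target q A u t (chain_residual A t) (J' n w)).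
Proof.
move=> IH mA pF Fs h sk tE ut; subst t.
apply: (first_step hq hstrict flowP) => //.
- by move=> v; exact: measurable_chain_law.
- move=> v F' vt vu pF' Fs'; apply: (IH (subv (residual k s) v) _ _ _ _ _ _ flowP
    n (s + toZ v)%R k F' A) => //.
  (* [v] is nonzero because it does not lie below [u], hence the weight drops. *)
  + apply: weight_subv => //; apply/eqP => v0; apply: vu.
    by rewrite v0 => i; rewrite ffunE.
  + exact/levZ_residual.
  + exact: residualD.
Qed.

(** Steps are almost surely nonzero, so a jump out of level 0 can be inserted for free, which gives
    events the shape that [restarts_step] expects. *)
Lemma flow_jump0 n F A : measurable F -> measurable A ->
  P ((F `&` jump J' S' n 0%R) `&` A) = P (F `&` A).
Proof.
move=> mF mA; have [N [mN N0 Npath]] := flow_strict_path hq hstrict flowP.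
apply: (measure_eq_off_null mN N0).
- by apply: measurableI => //; apply: measurableI => //; exact: measurable_jump.
- exact: measurableI.
- move=> w Nw; split=> [[[Fw _] Aw]//|[Fw Aw]]; split => //; split => //.
  have [_ /(_ n)[v v0 e]] : strict_path S' w.
    by apply: contrapT => c; apply: Nw; apply: Npath.
  by exists v => //= /lev0 v0'; rewrite v0' eqxx in v0.
Qed.

End one_step.

(** Renewal equation of the chain: the one-step formula at time 0 with [s = 0] and [u = 0], where
    the weight is 1. *)
Lemma chain_law_rec t A y :
  (forall t', (weight t' < weight t)%N -> restarts t') -> measurable A ->
  chain_law t A y = step_target q A 0%R t (chain_residual A t) y.
Proof.
move=> IH mA; have fl := Py_flow y.
have lev0t u : lev 0%R u by move=> i; rewrite ffunE.
have s0 : levZ (0%R : Zvec d) t by move=> i; rewrite ffunE.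
have e0 : (0%R : Zvec d) = (- toZ 0)%R by apply/ffunP => i; rewrite !ffunE.
have rE : residual t (0%R : Zvec d) = t by rewrite e0 residual_opp addr0.
have wE : ofZ (- (0%R : Zvec d))%R = 0%R by rewrite e0 opprK toZK.
have [N [mN N0 Ninit]] := (hPy y).1.
have init w : ~ N w -> J 0%N w = y /\ S 0%N w = 0%R.
  by move=> Nw; apply: contrapT => c; apply: Nw; apply: Ninit.
have mS0 : measurable (S 0%N @^-1` [set 0%R]) by exact: measurable_S.
have mZ := @measurable_Zpre _ _ _ _ _ J S t A mA.
have mj := measurable_jump J S 0 0%R.
transitivity (Py y ((S 0%N @^-1` [set 0%R] `&` jump J S 0 0%R) `&`
                    Zfield J S t @^-1` A)).
  rewrite (flow_jump0 fl)//; apply: (measure_eq_off_null mN N0) => //.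
    exact: measurableI.
  by move=> w /init[_ S0]; split=> [Zw|[]//]; split.
rewrite (restarts_step fl (t := t) (s := 0%R))//; last 2 first.
- exact: past_S.
- by rewrite wE.
transitivity (\int[Py y]_(w in setT) step_target q A 0%R t (chain_residual A t) y).
  apply: (integral_eq_off_null mN N0) => //.
  - apply: emeasurable_funM.
      apply/measurable_EFinP.
      apply: (measurableT_comp (measurable_step_weight _ 0 0%R)).
      exact: measurable_funPT.
    exact: (measurableT_comp (measurable_step_target _ _ mA)).
  - by move=> w; rewrite mule_ge0 ?lee_fin ?step_weight_ge0// step_target_ge0.
  - by move=> w; exact: step_target_ge0.
  - by move=> w /init[_ S0]; split.
  - move=> w /init[-> _] _; rewrite /step_weight wE.
    have := Hinv_Hbar hq (x := y) (u := 0%R).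
    by rewrite (Hbar0 hq hstrict) mule1 => ->//; rewrite mul1e.
rewrite integral_cst//; have -> : Py y setT = 1 by exact: prob_kernel.
by rewrite mule1.
Qed.

(** Strong induction on the weight: the one-step formula for the flow at time [n + 1] and the
    renewal equation of the chain have the same right-hand side. *)
Lemma restart t : restarts t.
Proof.
have [j] := ubnP (weight t); elim: j t => // j IHj t tj.
have IH t' : (weight t' < weight t)%N -> restarts t'.
  by move=> t't; apply: IHj; rewrite -ltnS (leq_trans _ tj).
move=> dO' Omega' J' S' P fl n s k F A sk tE pF Fs mA.
have mF := past_measurable pF.
have mZ := @measurable_Zpre _ _ _ _ _ J' S' k A mA.
rewrite -(flow_jump0 fl n.+1 mF mZ) (restarts_step fl (t := t) (s := s))//; last first.
  by move=> i; rewrite ffunE.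
by apply: eq_integral => w _; rewrite mul1e chain_law_rec.
Qed.

(** Two rectangles are in play: the jump leaves the one below [k], while the target is read in the
    one below [k + h], whose residual is larger by [h]. *)
Lemma field_step (dO' : measure_display) (Omega' : measurableType dO')
    (J' : nat -> {mfun Omega' >-> X}) (S' : nat -> {mfun Omega' >-> Zvec d})
    (P : {measure set Omega' -> \bar R}) n s k h F A :
  renewal_flow q J' S' P -> measurable A -> sigma_past J' S' n F ->
  F `<=` S' n @^-1` [set s] -> levZ s k -> (n = 0%N -> levZ s 0%R) ->
  P ((F `&` jump J' S' n (residual k s)) `&` Zfield J' S' (k + h)%R @^-1` A) =
  \int[P]_(w in F) ((step_weight q n s (J' n w))%:E *
    step_target q A (residual k s) (residual k s + h)%R
      (chain_residual A (residual k s + h)%R) (J' n w)).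
Proof.
move=> fl mA pF Fs sk s0; apply: (restarts_step fl) => //.
- by move=> t' _; exact: restart.
- by move=> /s0; exact: lev_opp_residual.
- by move=> i; apply: le_trans (sk i) _; rewrite lez_nat lev_addr.
- exact: residual_addn.
- exact: lev_addr.
Qed.

Lemma LambdaE h x u A : Espace q (x, u) ->
  Lambda q Py J S h (x, u) A =
  (Hinv q u x)%:E *
    step_target q A u (u + h)%R (chain_residual A (u + h)%R) x.
Proof.
move=> Ex; rewrite /Lambda /Rker /= !(inve_Hbar hq)//.
have -> : (\1_(A `*` [set: Nvec d]) (x, (u + h)%R))%:E = (\1_A x)%:E :> \bar R.
  rewrite !indicE; congr (_%:R%:E); congr nat_of_bool.
  by apply/idP/idP => /set_mem => [[/= Ax _]|Ax]; apply/mem_set.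
rewrite /step_target ge0_muleDr; last 2 first.
- by rewrite mule_ge0 ?Hbar_ge0// lee_fin.
- apply: esum_ge0 => v _; apply: integral_ge0 => y _; exact: chain_law_ge0.
congr (_ + _); first by rewrite muleA (muleC (Hbar _ _ _)).
congr (_ * _); apply: eq_esum => v _; apply: eq_integral => y _.
by rewrite /Kker; congr (Py y _); apply/seteqP; split => w // [].
Qed.

(** Multiplied by the tail, the lumping identity holds for every pair [(x, u)]: off [Espace] all
    steps outside [u] have mass 0 and both sides vanish. Hence [(J_n, u)] need not be shown to lie
    in [Espace] along the path. *)
Lemma lumps_target h (Ph : R.-pker X ~> X) u x A : lumps q Py J S h Ph ->
  measurable A ->
  step_target q A u (u + h)%R (chain_residual A (u + h)%R) x =
  Hbar q u x * Ph x A.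
Proof.
move=> lu mA; have := Hbar_ge0 q u x; rewrite le_eqVlt => /predU1P[/esym H0|H0].
  have Huh : Hbar q (u + h)%R x = 0.
    by apply: (esum_q_eq0 H0) => v vuh vu; apply: vuh; apply: lev_trans vu (lev_addr _ _).
  rewrite H0 mul0e /step_target Huh mul0e add0e; apply: esum1 => v [_ vu].
  have mz : q v x setT = 0.
    by apply/eqP; rewrite eq_le measure_ge0 andbT -H0 ker_le_Hbar.
  apply: null_set_integral => //; exact: measurable_chain_law.
by rewrite -(lu A x u mA H0) LambdaE// muleCA muleA Hinv_Hbar// mul1e.
Qed.

End restart.

(** * Leaving a rectangle *)

Section rectangle.
Local Open Scope ereal_scope.
Context (R : realType) (d : nat) (dX : measure_display) (X : measurableType dX).
Variable q : Nvec d -> R.-ker X ~> X.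
Hypothesis hq : renewal_kernel q.
Hypothesis hstrict : strict_kernel q.
Context (dO : measure_display) (Omega : measurableType dO).
Context (J : nat -> {mfun Omega >-> X}) (S : nat -> {mfun Omega >-> Zvec d}).

Lemma sigma_rect_measurable k E : sigma_rect J S k E -> measurable E.
Proof.
apply: smallest_sub; first exact: sigma_algebra_measurable.
by move=> _ [m _ [A mA <-]]; rewrite setTI; exact: measurable_Zpre.
Qed.

(** The sets with this property form a sigma-algebra, closed under complement because the comparison
    is an equivalence on one fixed slice; only the generators need work. *)
Lemma sigma_rect_past k E n : sigma_rect J S k E ->
  exists2 F, sigma_past J S n F & forall w, strict_path S w ->
    levZ (S n w) k -> ~ levZ (S n.+1 w) k -> (E w <-> F w).
Proof.
pose C := [set E | exists2 F, sigma_past J S n F & forall w, strict_path S w ->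
    levZ (S n w) k -> ~ levZ (S n.+1 w) k -> (E w <-> F w)].
rewrite -[exists2 F, _ & _]/(C E); move: E; apply: smallest_sub.
  split.
  - by exists set0 => //; exact: (@measurable0 _ (past_space J S n)).
  - move=> A [F pF AF]; exists (~` F); first exact: (@measurableC _ (past_space J S n)).
    move=> w sw h1 h2; split=> [[_ nA] Fw|nF]; first by apply: nA; apply/AF.
    by split=> // Aw; apply: nF; apply/AF.
  - move=> A CA; pose F i := projT1 (cid2 (CA i)).
    have pF i : sigma_past J S n (F i) := s2valP (cid2 (CA i)).
    exists (\bigcup_i F i).
      exact: (@bigcupT_measurable _ (past_space J S n)).
    move=> w sw h1 h2; split=> -[i _ iw]; exists i => //.
      by apply/(s2valP' (cid2 (CA i)) w sw h1 h2).
    by apply/(s2valP' (cid2 (CA i)) w sw h1 h2).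
move=> _ [m mk [A mA <-]]; rewrite setTI.
(* [F j] says that [j] is the last index below [m]. For [j = n] the exit condition is dropped: it
   would involve [S_(n+1)], which is outside the past, and it is automatic since [S_(n+1)] is not
   below [k] and [m] is. *)
pose F j := S j @^-1` [set s | levZ s m] `&`
  (if j == n then setT else S j.+1 @^-1` [set s | ~ levZ s m]) `&` J j @^-1` A.
exists (\bigcup_(j in [set j | (j <= n)%N]) F j).
  rewrite sigma_pastE; apply: bigcup_measurable => j /= jn.
  apply: measurableI; last exact: past_J.
  apply: measurableI; first exact: past_S.
  case: eqP => [_|/eqP jn']; first exact: measurableT.
  by apply: past_S; rewrite ltn_neqAle jn'.
move=> w sw h1 h2; split.
- move=> Aw; have [N1 N2] := Ncount_spec m sw.
  exists (Ncount S m w) => /=.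
    rewrite leqNgt; apply/negP => nN; apply: h2.
    have h3 := strict_path_levZ sw nN N1.
    by move=> i; apply: le_trans (h3 i) _; rewrite lez_nat; exact: mk.
  by split=> //; split=> //; case: eqP.
- move=> [j /= jn [[h3 h4] Aw]]; rewrite /preimage /= /rhoY /Yfield /= /Zfield.
  rewrite (Ncount_unique sw h3)//; case: eqP h4 => // -> _ h4; apply: h2.
  by move=> i; apply: le_trans (h4 i) _; rewrite lez_nat; exact: mk.
Qed.

Lemma strict_path_jump w n k : strict_path S w -> levZ (S n w) k ->
  jump J S n (residual k (S n w)) w <-> ~ levZ (S n.+1 w) k.
Proof.
move=> [_ /(_ n)[v _ e]] sk.
have e' : S n.+1 w = (S n w + toZ v)%R by rewrite -e addrC subrK.
rewrite e'; split=> [[v' /= v'k [_ e2]] h|h].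
  by apply: v'k; apply/levZ_residual => //; rewrite -e2 e.
by exists v => //= vk; apply: h; exact/levZ_residual.
Qed.

Section law.
Variable P : {measure set Omega -> \bar R}.
Hypothesis flowP : renewal_flow q J S P.

(** From [S_0 = - u], a first step leaving the rectangle below [u] leaves the one below 0, so
    [Ncount] at 0 is 0. *)
Lemma flow_Zfield0 : {ae P, forall w, Zfield J S 0%R w = J 0%N w}.
Proof.
apply: filterS2 (flow_ae_jump hq hstrict flowP 0) (flow_strict_path hq hstrict flowP).
move=> w jw sw; rewrite /Zfield.
have [[u e] _] := sw.
have s0 : levZ (S 0%N w) 0%R by rewrite e; exact: levZ_opp.
rewrite (Ncount_unique sw s0)//; apply/(strict_path_jump sw s0).
by move: jw; rewrite /exit_level e opprK toZK residual_opp add0r.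
Qed.

(** Given the past, the jump has probability weight times tail at [J_n]; disintegration along the
    Dirac kernel at [J_n] extends this from sets to functions. *)
Lemma integral_jump n s u F (g : X -> \bar R) :
  sigma_past J S n F -> F `<=` S n @^-1` [set s] ->
  (n = 0%N -> lev (ofZ (- s)%R) u) ->
  measurable_fun setT g -> (forall x, 0 <= g x) ->
  \int[P]_(w in F `&` jump J S n u) g (J n w) =
  \int[P]_(w in F) ((step_weight q n s (J n w))%:E *
                    (Hbar q u (J n w) * g (J n w))).
Proof.
move=> pF Fs h mg g0; have mF := past_measurable pF.
pose c w := (step_weight q n s (J n w) * fine (Hbar q u (J n w)))%R.
have cE w : (c w)%:E = (step_weight q n s (J n w))%:E * Hbar q u (J n w).
  by rewrite /c EFinM fineK// Hbar_fin.
rewrite (@integral_disintegration _ _ _ P _ X _ F (J n) c (fun w => \d_(J n w)))//.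
- apply: eq_integral => w _; rewrite integral_dirac// diracT mul1e cE.
  by rewrite muleA.
- by apply: measurableI => //; exact: measurable_jump.
- apply: measurable_funM.
    apply: (measurableT_comp (measurable_step_weight q n s)).
    exact: measurable_funPT.
  apply: measurableT_comp; first exact: fine_measurable.
  exact: (measurableT_comp (@measurable_Hbar _ _ _ _ q u)).
- by move=> w; rewrite mulr_ge0 ?step_weight_ge0// fine_ge0// Hbar_ge0.
- move=> A mA; apply/measurable_EFinP.
  have -> : (fun w => \1_A (J n w)) = \1_(J n @^-1` A) :> (Omega -> R) by [].
  by apply: measurable_indic; exact: measurable_J.
- move=> A mA; rewrite setIAC (flow_jump hq flowP (s := s))//; last 2 first.
  + rewrite sigma_pastE; apply: measurableI => //.
    exact: past_J.
  + by move=> w [/Fs].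
  rewrite integral_mkcondr; apply: eq_integral => w _.
  rewrite /patch cE [X in _ = _ * X](_ : _ = (J n w \in A)%:R%:E); last exact: diracE.
  case: ifPn => /=.
    by move=> /set_mem Aw; rewrite mem_set// mule1.
  by move=> /negP nA; rewrite memNset ?mule0// => Aw; apply: nA; exact: mem_set.
Qed.

Context (dO' : measure_display) (Omega' : measurableType dO').
Variables (Py : R.-pker X ~> Omega')
  (J' : nat -> {mfun Omega' >-> X}) (S' : nat -> {mfun Omega' >-> Zvec d}).
Hypothesis hPy : forall y : X, renewal_chain_from q J' S' (Py y) y.
Variables (h : Nvec d) (Ph : R.-pker X ~> X).
Hypothesis lumpsP : lumps q Py J' S' h Ph.

Lemma rect_step k E A : sigma_rect J S k E -> measurable A ->
  P (E `&` Zfield J S (k + h)%R @^-1` A) =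
  \int[P]_(w in E) Ph (Zfield J S k w) A.
Proof.
move=> rE mA; have mE := sigma_rect_measurable rE.
have mZ := @measurable_Zpre _ _ _ _ _ J S (k + h)%R A mA.
have mPh : measurable_fun setT (fun x => Ph x A) by exact: measurable_kernel.
have mPhZ : measurable_fun setT (fun w => Ph (Zfield J S k w) A).
  exact: (measurableT_comp mPh (measurable_Zfield J S k)).
pose D (p : nat * Zvec d) := [set w | Ncount S k w = p.1] `&` S p.1 @^-1` [set p.2].
have mD p : measurable (D p).
  by apply: measurableI; [exact: measurable_Ncount|exact: measurable_S].
have tD : trivIset setT D.
  apply/trivIsetP => -[n s] [n' s'] _ _ /eqP pp; rewrite -subset0.
  by move=> w [[/= e1 e2] [/= e1' e2']]; apply: pp; rewrite -e1 -e1' -[s]e2 -[s']e2' -e1 -e1'.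
have UD B : B = \bigcup_(p in setT) (B `&` D p).
  apply/seteqP; split=> [w Bw|w [p _ []//]].
  by exists (Ncount S k w, S (Ncount S k w) w).
rewrite [in LHS](UD (E `&` _)) [in RHS](UD E).
rewrite measure_bigcup_esum; last 2 first.
- by move=> p _; apply: measurableI => //; exact: measurableI.
- exact: trivIset_setIl.
rewrite integral_bigcup_esum//; last 2 first.
- by move=> p _; exact: measurableI.
- exact: trivIset_setIl.
apply: eq_esum => -[n s] _.
have [N [mN N0 Ngood]] : {ae P, forall w, strict_path S w}.
  exact: flow_strict_path flowP.
have good w : ~ N w -> strict_path S w.
  by move=> Nw; apply: contrapT => c; apply: Nw; exact: Ngood.
(* Pairs failing these bounds index null slices: a strict path is below [k] at time [Ncount], and
   its start is nonpositive. The bound at time 0 feeds [lev_opp_residual]. *)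
have [[sk s0]|nsk] := pselect (levZ s k /\ (n = 0%N -> levZ s 0%R)); last first.
  have nD w : ~ N w -> ~ D (n, s) w.
    move=> /good sw [/= Nn Ss]; apply: nsk; split.
      by rewrite -Ss -Nn; exact: (Ncount_spec k sw).1.
    move=> n0; rewrite -Ss n0; case: sw => -[u ->] _; exact: levZ_opp.
  transitivity (P set0).
    apply: (measure_eq_off_null mN N0) => //.
      by apply: measurableI => //; exact: measurableI.
    by move=> w /nD nDw; split=> // -[].
  rewrite measure0 -(integral_set0 P (fun w => Ph (Zfield J S k w) A)).
  apply: (integral_eq_off_null mN N0) => //; first exact: measurableI.
  by move=> w /nD nDw; split=> // -[].
have [F pF EF] := sigma_rect_past n rE.
pose G := F `&` S n @^-1` [set s]; set u := residual k s.
have pG : sigma_past J S n G.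
  by rewrite sigma_pastE; apply: measurableI => //; exact: past_S.
have Gs : G `<=` S n @^-1` [set s] by move=> w [].
have mG := past_measurable pG.
have mj := measurable_jump J S n u.
have pieceE w : ~ N w -> (E `&` D (n, s)) w <-> (G `&` jump J S n u) w.
  move=> /good sw; split=> [[Ew [/= Nn Ss]]|[[Fw Ss] jw]].
    have [N1 N2] := Ncount_spec k sw; rewrite Nn in N1 N2.
    split; first by split=> //; apply/EF.
    by rewrite /u -[s]Ss; apply/strict_path_jump.
  have N1 : levZ (S n w) k by rewrite [S n w]Ss.
  have N2 : ~ levZ (S n.+1 w) k.
    by apply/(strict_path_jump sw N1); rewrite [S n w]Ss.
  split; first by apply/EF.
  by split=> //; exact: Ncount_unique.
transitivity (P ((G `&` jump J S n u) `&` Zfield J S (k + h)%R @^-1` A)).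
  apply: (measure_eq_off_null mN N0).
  - by apply: measurableI => //; exact: measurableI.
  - by apply: measurableI => //; exact: measurableI.
  - move=> w Nw; split=> [[[Ew Zw] Dw]|[GJ Zw]].
      by split=> //; apply/pieceE.
    by have [Ew Dw] := (pieceE w Nw).2 GJ.
rewrite (field_step hq hstrict hPy h flowP mA pG Gs sk s0).
transitivity (\int[P]_(w in G `&` jump J S n u) Ph (J n w) A).
  rewrite (integral_jump (s := s) (u := u) (g := fun x => Ph x A) pG)//; last first.
    by move=> /s0; exact: lev_opp_residual.
  by apply: eq_integral => w _; rewrite (lumps_target hq _ _ lumpsP mA).
apply: (integral_eq_off_null mN N0) => //.
- exact: measurableI.
- exact: measurableI.
- exact: (measurableT_comp mPh).
- by move=> w Nw; apply: iff_sym; exact: pieceE.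
- move=> w Nw GJ; have [_ [/= Nn _]] := (pieceE w Nw).2 GJ.
  by rewrite /Zfield Nn.
Qed.

End law.
End rectangle.

(** * Lumping implies the Markov property *)

Section bounded_functions.
Local Open Scope ereal_scope.
Context (R : realType) (dT : measure_display) (T : measurableType dT).
Variable mu : {measure set T -> \bar R}.
Hypothesis mu_fin : mu setT < +oo.

Lemma bounded_integrable (F : T -> \bar R) (M : R) :
  measurable_fun setT F -> (forall x, `|F x| <= M%:E) ->
  mu.-integrable setT F.
Proof.
move=> mF FM; apply/integrableP; split => //.
apply: (@le_lt_trans _ _ (\int[mu]_(x in setT) `|M|%:E)).
  apply: ge0_le_integral => //; first exact: measurableT_comp.
  by move=> x _; apply: le_trans (FM x) _; rewrite lee_fin ler_norm.
by rewrite integral_cst// lte_mul_pinfty// lee_fin.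
Qed.

Lemma integral_shift (E : set T) (F : T -> \bar R) (M : R) :
  measurable E -> mu.-integrable setT F ->
  \int[mu]_(x in E) (F x + M%:E) = \int[mu]_(x in E) F x + M%:E * mu E.
Proof.
move=> mE iF; rewrite integralD//.
- by rewrite integral_cst.
- exact: integrableS iF.
- apply: (@integrableS _ _ _ _ setT) => //.
  by apply: (@bounded_integrable _ `|M|) => // x; rewrite abse_EFin.
Qed.

End bounded_functions.

Section L2_L1.
Local Open Scope ereal_scope.
Context (R : realType) (d : nat) (dX : measure_display) (X : measurableType dX).
Variable q : Nvec d -> R.-ker X ~> X.
Hypothesis hq : renewal_kernel q.
Hypothesis hstrict : strict_kernel q.
Context (dO : measure_display) (Omega : measurableType dO).
Variables (Py : R.-pker X ~> Omega)
  (J : nat -> {mfun Omega >-> X}) (S : nat -> {mfun Omega >-> Zvec d}).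
Hypothesis hPy : forall y : X, renewal_chain_from q J S (Py y) y.
Variable Ph : Nvec d -> R.-pker X ~> X.
Hypothesis lumpsP : forall h, lumps q Py J S h (Ph h).

Lemma flow_rect_markov (dO' : measure_display) (Omega' : measurableType dO')
    (P : {measure set Omega' -> \bar R})
    (J' : nat -> {mfun Omega' >-> X}) (S' : nat -> {mfun Omega' >-> Zvec d}) :
  renewal_flow q J' S' P -> rect_markov J' S' P Ph.
Proof.
move=> fl k h f mf [M fM]; have [PT _ _ _] := fl.
have Pfin : P setT < +oo by rewrite PT ltry.
pose K x := \int[Ph h x]_y (f y)%:E.
have mfE : measurable_fun setT (fun y => (f y)%:E) by exact/measurable_EFinP.
have fME y : `|(f y)%:E| <= M%:E by rewrite abse_EFin lee_fin.
have Phfin x : Ph h x setT < +oo by rewrite prob_kernel ltry.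
have fint x : (Ph h x).-integrable setT (fun y => (f y)%:E).
  exact: bounded_integrable fME.
(* Disintegration needs a nonnegative integrand, so [f] is shifted by its bound; the finite term
   [M * P E] is cancelled at the end. *)
pose g y := (f y)%:E + M%:E.
have g0 y : 0 <= g y.
  by rewrite /g -EFinD lee_fin -lerBlDr sub0r; have := fM y; rewrite ler_norml => /andP[].
have mg : measurable_fun setT g by apply: emeasurable_funD.
have KE x : \int[Ph h x]_y g y = K x + M%:E.
  by rewrite integral_shift// prob_kernel mule1.
have KM x : `|K x| <= M%:E.
  apply: le_trans (le_abse_integral _ _ _) _ => //.
  apply: (@le_trans _ _ (\int[Ph h x]_y (cst M%:E) y)).
    by apply: ge0_le_integral => //; exact: measurableT_comp.
  by rewrite integral_cst// prob_kernel mule1.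
have mK : measurable_fun setT K.
  have -> : K = (fun x => \int[Ph h x]_y g y - M%:E).
    by apply/funext => x; rewrite KE addeK.
  apply: emeasurable_funB => //.
  by apply: measurable_fun_integral_kernel => // U mU; exact: measurable_kernel.
have mZ j : measurable_fun setT (rhoY J' S' j) by exact: measurable_Zfield.
have iZ : P.-integrable setT (fun w => (f (rhoY J' S' (k + h)%R w))%:E).
  apply: (bounded_integrable Pfin (M := M)) => //.
  exact: (measurableT_comp mfE).
have iK : P.-integrable setT (fun w => K (rhoY J' S' k w)).
  by apply: (bounded_integrable Pfin (M := M)) => //; exact: (measurableT_comp mK).
split => //.
- move=> B mB; apply: sub_gen_smallest; exists k => //.
  exists (K @^-1` B); last by rewrite setTI.
  by rewrite -[_ @^-1` _]setTI; exact: mK.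
- move=> E rE; have mE := sigma_rect_measurable rE.
  have : \int[P]_(w in E) g (rhoY J' S' (k + h)%R w) =
      \int[P]_(w in E) (K (rhoY J' S' k w) + M%:E).
    rewrite (@integral_disintegration _ _ _ P _ X E E _ (fun=> 1%R)
      (fun w => Ph h (rhoY J' S' k w)))//.
    + by apply: eq_integral => w _; rewrite mul1e KE.
    + move=> A mA.
      exact: (measurableT_comp (measurable_kernel (Ph h) _ mA) (mZ k)).
    + move=> A mA; rewrite (rect_step hq hstrict fl hPy (lumpsP h) rE mA).
      by apply: eq_integral => w _; rewrite mul1e.
  rewrite !integral_shift// => e.
  have PEfin : M%:E * P E \is a fin_num.
    rewrite fin_numM// ge0_fin_numE// (le_lt_trans _ Pfin)//.
    by apply: le_measure; rewrite ?inE.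
  by rewrite -[LHS](addeK _ PEfin) -e addeK.
Qed.

Lemma lumps_L1 : L1 q.
Proof.
exists Ph => mu muE dO' Omega' P J' S' field.
apply: flow_rect_markov; apply: field_flow field => //.
exact: probability_setT.
Qed.

(** The Markov property at [k = 0] on the whole space, where the field is almost surely at [x]. It
    exhibits [Ph h x] as a law of the chain, from which the semigroup law is read off. *)
Lemma lumps_chain_law h x A : measurable A ->
  Py x (Zfield J S h @^-1` A) = Ph h x A.
Proof.
move=> mA; have fl := Py_flow hq hstrict hPy x.
have rT : sigma_rect J S 0%R setT.
  exact: (@measurableT _ (g_sigma_algebraType _)).
have := rect_step hq hstrict fl hPy (lumpsP h) rT mA.
rewrite setTI add0r => ->.
have [N [mN N0 Ninit]] : {ae Py x, forall w, Zfield J S 0%R w = x}.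
  apply: filterS2 (flow_Zfield0 hq hstrict fl) (hPy x).1.
  by move=> w -> [].
transitivity (\int[Py x]_(w in setT) Ph h x A).
  apply: (integral_eq_off_null mN N0) => //.
    exact: (measurableT_comp (measurable_kernel (Ph h) _ mA) (measurable_Zfield J S 0%R)).
  move=> w Nw _; have -> // : Zfield J S 0%R w = x.
  by apply: contrapT => c; apply: Nw; exact: Ninit.
by rewrite integral_cst// prob_kernel mule1.
Qed.

Lemma lumps_semigroup : markov_semigroup Ph.
Proof.
split=> [x A mA|h r x A mA].
  have E0 := Espace0 hq hstrict x.
  rewrite -(lumpsP 0%R mA E0) (LambdaE hq Py J S 0%R A E0) addr0 /step_target.
  (* For [h = 0] no [v] lies both below [u] and outside it. *)
  rewrite esum1 ?adde0; last by move=> v [].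
  by rewrite muleA Hinv_Hbar// mul1e diracE indicE.
have fl := Py_flow hq hstrict hPy x.
have rT : sigma_rect J S h setT.
  exact: (@measurableT _ (g_sigma_algebraType _)).
rewrite -lumps_chain_law//.
have := rect_step hq hstrict fl hPy (lumpsP r) rT mA.
rewrite setTI => ->; rewrite /kcomp_noparam.
(* The law of the field at [h] is [Ph h x], so a constant kernel turns the expectation into the
   composition of kernels. *)
rewrite (@integral_disintegration _ _ _ (Py x) _ X setT setT _ (fun=> 1%R)
  (fun=> Ph h x) (fun y => Ph r y A))//.
- under eq_integral do rewrite mul1e.
  by rewrite integral_cst// prob_kernel mule1.
- exact: measurable_Zfield.
- move=> B mB; under eq_integral do rewrite mul1e.
  by rewrite setTI lumps_chain_law// integral_cst// prob_kernel mule1.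
- exact: measurable_kernel.
Qed.

Lemma lumps_commute : coordinates_commute Ph.
Proof.
move=> i j x A mA; have [_ semi] := lumps_semigroup.
by rewrite -!semi// addrC.
Qed.

End L2_L1.

(** * The Markov property implies lumping *)

Section conditioning.
Local Open Scope ereal_scope.
Context (R : realType) (dT : measure_display) (T : measurableType dT).
Variable P : {measure set T -> \bar R}.

Lemma conditional_probability (D : set T) :
  measurable D -> 0 < P D -> P D < +oo ->
  exists P' : probability T R,
    (forall A, measurable A -> P' A = ((fine (P D))^-1)%:E * P (D `&` A)) /\
    (forall E (f : T -> \bar R), measurable E -> measurable_fun setT f ->
       (forall w, 0 <= f w) ->
       \int[P']_(w in E) f w = ((fine (P D))^-1)%:E * \int[P]_(w in D `&` E) f w).
Proof.
move=> mD D0 Doo.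
have Dfin : P D \is a fin_num by rewrite ge0_fin_numE.
have D1 : ((fine (P D))^-1)%:E * P D = 1.
  by rewrite -[in X in _ * X](fineK Dfin) -EFinM mulVf// gt_eqF// fine_gt0// D0.
exists (mnormalize (mrestr P mD) (\d_(point : T))).
set P' := mnormalize _ _.
have P'E A : measurable A -> P' A = ((fine (P D))^-1)%:E * P (D `&` A).
  move=> mA; rewrite /P' /= /mnormalize /= /mrestr setTI ifF; first by rewrite muleC setIC.
  by apply/negbTE; rewrite negb_or gt_eqF// lt_eqF.
split=> // E f mE mf f0.
have mfE : measurable_fun setT (f \_ E) by apply/(measurable_restrictT _ mE); exact: measurable_funTS.
have fE0 w : 0 <= (f \_ E) w by rewrite /patch; case: ifP.
rewrite integral_mkcondr [LHS]integral_mkcond.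
(* On [D], the measure [P] is [P D] times [P']: a disintegration with the identity map and the
   constant kernel [P']. *)
have := @integral_disintegration _ _ T P _ T D D id (fun=> 1%R) (fun=> P') (f \_ E)
  mD mD _ _ _ _ _ mfE fE0.
move=> -> //.
- by under [in RHS]eq_integral do rewrite mul1e; rewrite integral_cst// muleCA D1 mule1.
- move=> A mA; under eq_integral do rewrite mul1e.
  rewrite integral_cst// [X in _ = X * _](_ : _ = ((fine (P D))^-1)%:E * P (D `&` A)).
    by rewrite muleAC D1 mul1e.
  exact: P'E.
Qed.

End conditioning.

Section L1_L2.
Local Open Scope ereal_scope.
Context (R : realType) (d : nat) (dX : measure_display) (X : measurableType dX).
Variable q : Nvec d -> R.-ker X ~> X.
Hypothesis hq : renewal_kernel q.
Hypothesis hstrict : strict_kernel q.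
Context (dO : measure_display) (Omega : measurableType dO).
Variables (Py : R.-pker X ~> Omega)
  (J : nat -> {mfun Omega >-> X}) (S : nat -> {mfun Omega >-> Zvec d}).
Hypothesis hPy : forall y : X, renewal_chain_from q J S (Py y) y.
Variables (x : X) (u : Nvec d).

(** The chain starts at [x] and 0 only almost surely. Overwriting time 0 by constants makes the past
    at time 0 trivial and the conditional law of the first step constant; the shift of later sums by
    [- u] cancels in every later increment. *)
Definition pinned_pos n : Omega -> X := if n is 0 then cst x else J n.

Definition pinned_sum n : Omega -> Zvec d :=
  if n is 0 then cst (- toZ u)%R else fun w => (S n w - toZ u)%R.

Lemma measurable_pinned_pos n : measurable_fun setT (pinned_pos n).
Proof. by case: n => [|n]; [exact: measurable_cst|exact: measurable_funPT]. Qed.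

Lemma measurable_pinned_sum n : measurable_fun setT (pinned_sum n).
Proof.
case: n => [|n]; first exact: measurable_cst.
move=> _ B _; rewrite setTI.
exact: (measurable_S S n.+1 [set s | B (s - toZ u)%R]).
Qed.

Definition pinJ n : {mfun Omega >-> X} :=
  HB.pack (pinned_pos n) (isMeasurableFun.Build _ _ _ _ _ (measurable_pinned_pos n)).

Definition pinS n : {mfun Omega >-> Zvec d} :=
  HB.pack (pinned_sum n) (isMeasurableFun.Build _ _ _ _ _ (measurable_pinned_sum n)).

Lemma past_pinned n E : sigma_past pinJ pinS n E -> sigma_past J S n E.
Proof.
apply: smallest_sub; first exact: smallest_sigma_algebra.
have trivial_pre U (B : set U) b : sigma_past J S n ((fun=> b) @^-1` B).
  have [Bb|nBb] := pselect (B b).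
    rewrite (_ : _ @^-1` _ = setT); last by apply/seteqP; split.
    by rewrite sigma_pastE; exact: measurableT.
  rewrite (_ : _ @^-1` _ = set0); last by apply/seteqP; split.
  by rewrite sigma_pastE; exact: measurable0.
move=> _ [m mn [[A mA <-]|[A mA <-]]]; rewrite setTI.
  case: m mn => [|m] mn; first exact: (trivial_pre _ A x).
  by rewrite -[pinJ _ @^-1` _]/(J m.+1 @^-1` A); exact: past_J.
case: m mn => [|m] mn; first exact: (trivial_pre _ A (- toZ u)%R).
rewrite -[pinS _ @^-1` _]/(S m.+1 @^-1` [set s | A (s - toZ u)%R]).
exact: past_S.
Qed.

Lemma past_pinned0 E : sigma_past pinJ pinS 0 E -> E = set0 \/ E = setT.
Proof.
pose C := [set E : set Omega | E = set0 \/ E = setT].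
rewrite -[_ \/ _]/(C E); move: E; apply: smallest_sub.
  split; first by left.
  - by move=> A [->|->]; [right; rewrite setD0|left; rewrite setDv].
  - move=> F FC; have [[i Fi]|h] := pselect (exists i, F i = setT).
      by right; apply/seteqP; split=> // w _; exists i => //; rewrite Fi.
    left; rewrite bigcup0// => i _; have [//|Fi] := FC i.
    by exfalso; apply: h; exists i.
have trivial_pre U (B : set U) b : C ((fun=> b) @^-1` B).
  have [Bb|nBb] := pselect (B b); [right|left].
    by apply/seteqP; split.
  by apply/seteqP; split.
move=> _ [m /= m0 [[A mA <-]|[A mA <-]]]; rewrite setTI;
  move: m0; rewrite leqn0 => /eqP ->.
  exact: (trivial_pre _ A x).
exact: (trivial_pre _ A (- toZ u)%R).
Qed.

Let init : {ae Py x, forall w, J 0%N w = x /\ S 0%N w = 0%R} := (hPy x).1.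

Lemma chain_step0 k A : measurable A -> Py x (step J S 0 k A) = q k x A.
Proof.
move=> mA; have pT : sigma_past J S 0 setT by rewrite sigma_pastE; exact: measurableT.
have := transition_step k ((hPy x).2 0%N) mA pT; rewrite setTI => ->.
have [N [mN N0 Ninit]] := init.
transitivity (\int[Py x]_(w in setT) q k x A).
  apply: (integral_eq_off_null mN N0) => //.
    exact: (measurableT_comp (measurable_kernel (q k) _ mA)).
  move=> w Nw _; have [-> _] : J 0%N w = x /\ S 0%N w = 0%R.
    by apply: contrapT => c; apply: Nw; exact: Ninit.
  by [].
by rewrite integral_cst// prob_kernel mule1.
Qed.

Lemma chain_jump0 : Py x (jump J S 0 u) = Hbar q u x.
Proof.
rewrite /jump measure_bigcup_esum.
- by apply: eq_esum => v _; exact: chain_step0.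
- by move=> v _; exact: measurable_step.
- exact: trivIset_step.
Qed.

Lemma step_pinned n v A : step pinJ pinS n.+1 v A = step J S n.+1 v A.
Proof.
apply/seteqP; split => w [/= Aw e]; split => //.
  by rewrite -e /pinS /= opprB addrA subrK.
by rewrite /pinS /= opprB addrA subrK.
Qed.

Lemma pinned_field : Espace q (x, u) ->
  exists P : probability Omega R,
    renewal_field_from q pinJ pinS P (\d_(x, u)).
Proof.
move=> Exu; have mj := measurable_jump J S 0 u.
have [||P [PE PI]] := @conditional_probability _ _ _ (Py x) _ mj.
- by rewrite chain_jump0.
- by rewrite chain_jump0 (le_lt_trans (Hbar_le1 hq u x))// ltry.
rewrite chain_jump0 -/(Hinv q u x) in PE PI.
have Pfin : P setT < +oo by rewrite probability_setT ltry.
have mst n v A : measurable A -> measurable (step pinJ pinS n v A).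
  by move=> mA; exact: measurable_step.
have ist n v A : measurable A ->
    P.-integrable setT (fun w => (\1_(step pinJ pinS n v A) w)%:E).
  move=> mA; apply: (bounded_integrable Pfin (M := 1%R)).
    by apply/measurable_EFinP; apply: measurable_indic; exact: mst.
  by move=> w; rewrite abse_EFin lee_fin indicE normr_nat lern1 leq_b1.
have q1 v y A : measurable A -> `|q v y A| <= 1.
  move=> mA; rewrite gee0_abs//; apply: (@le_trans _ _ (q v y setT)).
    by apply: le_measure; rewrite ?inE.
  rewrite -(hq y) -(@esum_set1 _ _ v (fun v => q v y setT))//.
  by rewrite esum_mkcond; apply: le_esum => w _; case: ifPn.
have step0E v A : measurable A ->
    P (step pinJ pinS 0 v A) = qtrunc q u v x A.
  move=> mA; rewrite PE; last exact: mst.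
  rewrite (qtruncE hq)//; have [N [mN N0 Ninit]] := init.
  (* Pinning alters the first increment only through [S_0], which is almost surely 0. *)
  have eqst w : ~ N w -> step pinJ pinS 0 v A w <-> step J S 0 v A w.
    move=> Nw; have [_ S0] : J 0%N w = x /\ S 0%N w = 0%R.
      by apply: contrapT => c; apply: Nw; exact: Ninit.
    by rewrite /step /pinJ /pinS /= opprK subrK S0 subr0.
  case: asboolP => vu.
    rewrite (@measure_eq_off_null _ _ _ _ N _ set0) ?measure0 ?mule0//.
      by apply: measurableI => //; exact: mst.
    move=> w Nw; split=> // -[[v' /= v'u [_ e']] /(eqst w Nw)[_ e]].
    by apply: v'u; rewrite (_ : v' = v)//; apply: toZ_inj; rewrite -e -e'.
  congr (_ * _); rewrite -(chain_step0 v mA).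
  apply: (measure_eq_off_null mN N0).
  - by apply: measurableI => //; exact: mst.
  - exact: measurable_step.
  - move=> w Nw; split=> [[_ /(eqst w Nw)]//|sw].
    by split; [exists v => //; case: sw|exact/eqst].
exists P; split.
- move=> A u' mA; have [[Ax uu']|h] := pselect (A x /\ u = u').
    rewrite (_ : [set w | A (pinJ 0 w) /\ pinS 0 w = (- toZ u')%R] = setT).
      rewrite [LHS](_ : _ = 1); last exact: probability_setT.
      by rewrite [RHS](_ : _ = ((x, u) \in A `*` [set u'])%:R%:E); [rewrite mem_set|exact: diracE].
    by apply/seteqP; split => // w _ /=; rewrite /pinned_pos /pinned_sum uu'.
  rewrite (_ : [set w | A (pinJ 0 w) /\ pinS 0 w = (- toZ u')%R] = set0).
    rewrite [RHS](_ : _ = ((x, u) \in A `*` [set u'])%:R%:E); last exact: diracE.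
    by rewrite measure0 memNset// => -[/= Ax uu']; apply: h; split.
  apply/seteqP; split => // w [/= Ax e]; apply: h; split => //.
  by apply: toZ_inj; apply: oppr_inj.
- move=> v A mA.
  suff : is_cond_exp P (sigma_past pinJ pinS 0)
      (fun w => (\1_(step pinJ pinS 0 v A) w)%:E)
      (cst (qtrunc q (ofZ (- (- toZ u))%R) v x A)) by [].
  rewrite opprK toZK; split.
  + exact: ist.
  + apply: (bounded_integrable Pfin (M := 1%R)); first exact: measurable_cst.
    move=> w; rewrite -(step0E v A mA) gee0_abs//.
    by apply: probability_le1; exact: mst.
  + move=> B _; have [Bb|nBb] := pselect (B (qtrunc q u v x A)).
      rewrite (_ : _ @^-1` _ = setT); last by apply/seteqP; split.
      by rewrite sigma_pastE; exact: measurableT.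
    rewrite (_ : _ @^-1` _ = set0); last by apply/seteqP; split.
    by rewrite sigma_pastE; exact: measurable0.
  + move=> E /past_pinned0[->|->]; first by rewrite !integral_set0.
    rewrite integral_cst// [X in _ * X](_ : _ = 1); last exact: probability_setT.
    rewrite mule1 integral_indic//; last exact: mst.
    by rewrite setIT -step0E.
- move=> [//|n] _ v A mA; split.
  + exact: ist.
  + apply: (bounded_integrable Pfin (M := 1%R)); last by move=> w; exact: q1.
    exact: (measurableT_comp (measurable_kernel (q v) _ mA)).
  + move=> B mB; apply: (@past_J _ _ _ _ _ pinJ pinS n.+1 n.+1
      ((fun y => q v y A) @^-1` B)) => //.
    by rewrite -[_ @^-1` _]setTI; apply: measurable_kernel.
  + move=> E /[dup] /past_pinned pE /past_measurable mE.
    rewrite PI//; last exact: (measurableT_comp (measurable_kernel (q v) _ mA)).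
    rewrite integral_indic//; last exact: mst.
    rewrite [RHS](_ : _ = (Hinv q u x)%:E * Py x (jump J S 0 u `&`
      (step pinJ pinS n.+1 v A `&` E))); last first.
      by apply: PE; apply: measurableI => //; exact: mst.
    congr (_ * _); rewrite step_pinned (setIC (step _ _ _ _ _) E) setIA.
    rewrite (transition_step v ((hPy x).2 n.+1) mA)//.
    (* The conditioning event is decided by the first step, hence belongs to the past at every time
       from 1 on; conditioning leaves the later transitions unchanged. *)
    rewrite sigma_pastE; apply: measurableI => //.
    apply: measurable_bigcup_countType => k _.
    by apply: (@past_mono _ _ _ _ _ _ _ 1%N n.+1) => //; exact: past_step.
Qed.

Lemma dirac_Espace : Espace q (x, u) ->
  (\d_(x, u) : probability (X * Nvec d)%type R) (Espace q) = 1.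
Proof.
move=> Exu; rewrite [LHS](_ : _ = ((x, u) \in Espace q)%:R%:E); last exact: diracE.
by rewrite mem_set.
Qed.

Lemma rect_markov_lumps (Ph : Nvec d -> R.-pker X ~> X) (P : probability Omega R)
    h A : Espace q (x, u) -> measurable A ->
  renewal_field_from q pinJ pinS P (\d_(x, u)) -> rect_markov pinJ pinS P Ph ->
  Lambda q Py J S h (x, u) A = Ph h x A.
Proof.
move=> Exu mA field rm.
have fl := field_flow (probability_setT P) (dirac_Espace Exu) field.
have mZ := @measurable_Zpre _ _ _ _ _ pinJ pinS (0 + h)%R A mA.
have pT : sigma_past pinJ pinS 0 setT by rewrite sigma_pastE; exact: measurableT.
have rT : sigma_rect pinJ pinS 0%R setT.
  exact: (@measurableT _ (g_sigma_algebraType _)).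
have lawP : P (Zfield pinJ pinS (0 + h)%R @^-1` A) = Ph h x A.
  have [||_ _ _ ce] := rm 0%R h (\1_A).
  - exact: measurable_indic.
  - by exists 1%R => y; rewrite indicE normr_nat lern1 leq_b1.
  have := ce setT rT; rewrite [RHS](_ : _ = P (Zfield pinJ pinS (0 + h)%R @^-1` A)).
    move=> <-; have [N [mN N0 NZ]] := flow_Zfield0 hq hstrict fl.
    transitivity (\int[P]_(w in setT) Ph h x A).
      apply: (integral_eq_off_null mN N0) => //.
      + under eq_fun do rewrite integral_indic// setIT.
        exact: (measurableT_comp (measurable_kernel (Ph h) _ mA)
          (measurable_Zfield pinJ pinS 0%R)).
      + by move=> w; apply: integral_ge0.
      + move=> w Nw _; rewrite integral_indic// setIT.
        have -> // : rhoY pinJ pinS 0%R w = x.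
        by apply: contrapT => c; apply: Nw; exact: NZ.
    rewrite integral_cst// [X in _ * X](_ : _ = 1) ?mule1//.
    exact: probability_setT.
  by rewrite -[X in \int[P]_(w in _) (\1_X w)%:E]/(Zfield pinJ pinS (0 + h)%R @^-1` A)
    integral_indic// setIT.
rewrite -lawP LambdaE//.
have levu : levZ (- toZ u)%R (0%R : Nvec d) by exact: levZ_opp.
have resE : residual 0%R (- toZ u)%R = u by rewrite residual_opp add0r.
have := field_step (s := (- toZ u)%R) (n := 0) (k := 0%R) (F := setT)
  hq hstrict hPy h fl mA pT _ levu (fun=> levu).
rewrite resE setTI => stepP.
(* The first jump out of the rectangle below [u] is almost sure for the pinned field; it is inserted
   to match [field_step] at [k = 0]. *)
transitivity (P (jump pinJ pinS 0 u `&` Zfield pinJ pinS (0 + h)%R @^-1` A)).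
  rewrite stepP; last by [].
  under eq_integral do rewrite /step_weight opprK toZK /=.
  rewrite integral_cst// [X in _ = _ * X](_ : _ = 1) ?mule1//.
  exact: probability_setT.
have [N [mN N0 Nj]] := flow_ae_jump hq hstrict fl 0.
apply: (measure_eq_off_null mN N0) => //.
  by apply: measurableI => //; exact: measurable_jump.
move=> w Nw; split=> [[]//|Zw]; split=> //.
have : jump pinJ pinS 0 (exit_level 0 (pinS 0%N w)) w.
  by apply: contrapT => c; apply: Nw; exact: Nj.
by rewrite /exit_level /= opprK toZK.
Qed.

End L1_L2.

Theorem theorem7p2 (R : realType) (d : nat) (hd : (1 <= d)%N)
  (dX : measure_display) (X : measurableType dX) (hX : standard_borel R X)
  (q : Nvec d -> R.-ker X ~> X)
  (hq : renewal_kernel q) (hstrict : strict_kernel q)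
  (dO : measure_display) (Omega : measurableType dO)
  (Py : R.-pker X ~> Omega)
  (J : nat -> {mfun Omega >-> X}) (S : nat -> {mfun Omega >-> Zvec d})
  (hPy : forall y : X, renewal_chain_from q J S (Py y) y) :
  (L1 q <-> L2 q Py J S) /\
  (L2 q Py J S ->
   forall PZ : Nvec d -> R.-pker X ~> X,
     (forall h : Nvec d, lumps q Py J S h (PZ h)) ->
     markov_semigroup PZ /\ coordinates_commute PZ).
Proof.
split; last first.
  by move=> _ PZ lumpsPZ; split; [exact: lumps_semigroup lumpsPZ|exact: lumps_commute lumpsPZ].
split=> [[Ph markovPh] h|].
  exists (Ph h) => A x u mA Exu.
  have [P field] := pinned_field hq hPy Exu.
  apply: (rect_markov_lumps hq hstrict hPy h Exu mA field).
  exact: markovPh (dirac_Espace Exu) _ _ _ _ _ field.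
by move=> /choice[Ph lumpsPh]; exact: lumps_L1 lumpsPh.
Qed.
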